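(* If $A\in\mathbf{M}_n(\mathbb{C})$ is a nonscalar Hermitian matrix with eigenvalues $\lambda_1,\dots,\lambda_n\in\mathbb{R}$ (repeated according to multiplicity), then the numerical density $f_A:\mathbb{R}\to\mathbb{R}_+$ of $A$ is the normalized $B$-spline of degree $n-2$ whose knots are the eigenvalues of $A$; that is, $\mu_A$ is absolutely continuous with respect to Lebesgue measure on $\mathbb{R}$ and $f_A=\mathrm{d}\mu_A/\mathrm{d}x=B[\lambda_1,\dots,\lambda_n]$ almost everywhere.
   Context: $\mathbf{M}_n(\mathbb{C})$ is the space of complex $n\times n$ matrices; scalar means a multiple of the identity (so nonscalar forces $n\ge2$). The numerical measure $\mu_A$ is the image, under $x\mapsto\langle Ax,x\rangle$ (with $\langle x,y\rangle=y^*x$), of the normalized (probability) Euclidean surface measure on the unit sphere of $\mathbb{C}^n$; when $A$ is Hermitian it is regarded as a probability measure on $\mathbb{R}$. Divided differences: for pairwise distinct reals $\lambda_1,\dots,\lambda_n$ and a continuous function $g$, $\delta^{n-1}[\lambda_1,\dots,\lambda_n]g=\sum_{j=1}^n \frac{g(\lambda_j)}{\prod_{k\ne j}(\lambda_j-\lambda_k)}$, the leading (degree $n-1$) coefficient of the unique polynomial of degree at most $n-1$ agreeing with $g$ at the points $\lambda_j$. If the $\lambda_j$ are not all distinct, the divided difference is the extension by continuity in $(\lambda_1,\dots,\lambda_n)$ (equivalently, the degree $n-1$ coefficient of the Hermite interpolation polynomial of degree at most $n-1$, matching $g$ and its derivatives up to order $m_j-1$ at a knot of multiplicity $m_j$),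 for $g$ sufficiently smooth near the knots. Normalized $B$-spline of degree $n-2$ with knots $\lambda_1,\dots,\lambda_n$ (not all equal): $B[\lambda_1,\dots,\lambda_n](x)=(n-1)\,\delta^{n-1}[\lambda_1,\dots,\lambda_n]\,(\cdot-x)_+^{n-2}$, where $(\cdot-x)_+^{n-2}$ is the map $y\mapsto\max(0,y-x)^{n-2}$ (for $n=2$, the map equal to $1$ for $y>x$ and $0$ for $y<x$). This is defined at least for all $x\notin\{\lambda_1,\dots,\lambda_n\}$, hence almost everywhere. *)

(* Defs.v *)
From HB Require Import structures.
From mathcomp Require Import all_boot all_order all_algebra.
From mathcomp Require Import complex.
From mathcomp Require Import all_classical all_reals all_analysis.
From mathcomp Require Import measurable_realfun.

Set Implicit Arguments.
Unset Strict Implicit.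
Unset Printing Implicit Defensive.

Import Order.TTheory GRing.Theory Num.Theory.
Import numFieldNormedType.Exports.
Local Open Scope classical_set_scope.
Local Open Scope ring_scope.
Local Open Scope complex_scope.
Local Open Scope sesquilinear_scope.
Local Open Scope charge_scope.

(* The sigma-finite instance of [\x] is shadowed in the library by the one for *)
(* subprobabilities, hence this copy.                                          *)
Section prod_measure.
Context {d1 d2 : measure_display} {T1 : measurableType d1}
  {T2 : measurableType d2} {R : realType}.
Variables (mu : {sigma_finite_measure set T1 -> \bar R})
          (nu : {sigma_finite_measure set T2 -> \bar R}).

Definition prod_measure : set (T1 * T2) -> \bar R := (mu \x nu)%E.

HB.instance Definition _ := Measure.copy prod_measure (mu \x nu)%E.

Let prod_measure_sigma_finite : sigma_finite setT prod_measure.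
Proof.
have /sigma_finiteP[F [TF ndF Foo]] := sigma_finiteT mu.
have /sigma_finiteP[G [TG ndG Goo]] := sigma_finiteT nu.
exists (fun n => F n `*` G n).
  rewrite -setXTT TF TG predeqE => -[x y]; split.
    move=> [/= [n _ Fnx] [k _ Gky]]; exists (maxn n k) => //; split.
    - by move: x Fnx; exact/subsetPset/ndF/leq_maxl.
    - by move: y Gky; exact/subsetPset/ndG/leq_maxr.
  by move=> [n _ []/= ? ?]; split; exists n.
move=> k; have [? ?] := Foo k; have [? ?] := Goo k.
split; first exact: measurableX.
by rewrite /prod_measure product_measure1E// lte_mul_pinfty// ge0_fin_numE.
Qed.

HB.instance Definition _ := Measure_isSigmaFinite.Build _ _ _ prod_measure
  prod_measure_sigma_finite.

End prod_measure.

(* Finite powers of a sigma-finite measure: the product measure on             *)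
(* [n.-tuple T], whose sigma-algebra is generated by the coordinates.          *)

Section cons_measure.
Context {d : measure_display} {T : measurableType d} {R : realType} {n : nat}.
Variables (mu : {sigma_finite_measure set T -> \bar R})
          (nu : {sigma_finite_measure set (n.-tuple T) -> \bar R}).

Definition tuple_of_pair (p : T * n.-tuple T) : n.+1.-tuple T :=
  [tuple of p.1 :: p.2].

Lemma measurable_tuple_of_pair : measurable_fun setT tuple_of_pair.
Proof. by apply: measurable_cons; [exact: measurable_fst|exact: measurable_snd]. Qed.

Definition cons_measure : set (n.+1.-tuple T) -> \bar R :=
  pushforward (prod_measure mu nu) tuple_of_pair.

Let cons_measure0 : cons_measure set0 = 0%E.
Proof. by rewrite /cons_measure /pushforward preimage_set0 measure0. Qed.

Let cons_measure_ge0 A : (0 <= cons_measure A)%E.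
Proof. exact: (measure_ge0 (prod_measure mu nu)). Qed.

Let cons_measure_sigma_additive : semi_sigma_additive cons_measure.
Proof.
move=> F mF tF mUF; rewrite /cons_measure /pushforward preimage_bigcup.
have mp := measurable_tuple_of_pair.
apply: measure_semi_sigma_additive.
- by move=> k; rewrite -[X in measurable X]setTI; exact: mp.
- apply/trivIsetP => /= i j _ _ ij; rewrite -preimage_setI.
  by move/trivIsetP : tF => /(_ _ _ _ _ ij) ->//; rewrite preimage_set0.
- by rewrite -preimage_bigcup -[X in measurable X]setTI; exact: mp.
Qed.

HB.instance Definition _ := isMeasure.Build _ _ _ cons_measure
  cons_measure0 cons_measure_ge0 cons_measure_sigma_additive.

Let cons_measure_sigma_finite : sigma_finite setT cons_measure.
Proof.
have [G TG Goo] := sigma_finiteT (prod_measure mu nu).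
pose split (t : n.+1.-tuple T) : T * n.-tuple T := (thead t, [tuple of behead t]).
have msplit : measurable_fun setT split.
  apply/measurable_fun_pairP; split; first exact: measurable_tnth.
  exact: measurable_behead.
have splitK p : split (tuple_of_pair p) = p.
  by case: p => x t; congr pair; apply: val_inj.
exists (fun k => split @^-1` G k).
  by rewrite -preimage_bigcup -TG preimage_setT.
move=> k; have [mG fG] := Goo k; split.
  by rewrite -[X in measurable X]setTI; exact: msplit.
rewrite /cons_measure /pushforward -comp_preimage.
by rewrite (_ : split \o _ = id)// funeqE => p /=; rewrite splitK.
Qed.

HB.instance Definition _ := Measure_isSigmaFinite.Build _ _ _ cons_measure
  cons_measure_sigma_finite.

End cons_measure.

Fixpoint tuple_measure {d : measure_display} {T : measurableType d}
    {R : realType} (mu : {sigma_finite_measure set T -> \bar R}) (n : nat) :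
    {sigma_finite_measure set (n.-tuple T) -> \bar R} :=
  if n is k.+1 then cons_measure mu (tuple_measure mu k)
  else dirac ([tuple] : 0.-tuple T).

(* C^n is represented by the real coordinates (Re x_i, Im x_i) of its vectors, *)
(* so that it carries a sigma-algebra and Lebesgue measure.                    *)
Notation plane R := (measurableTypeR R * measurableTypeR R)%type.
Notation Cn R n := (n.-tuple (plane R)).

Section sphere.
Variables (R : realType) (n : nat).

Definition lebesgue_plane : {sigma_finite_measure set (plane R) -> \bar R} :=
  prod_measure (@lebesgue_measure R) (@lebesgue_measure R).

Definition lebesgue_Cn : {sigma_finite_measure set (Cn R n) -> \bar R} :=
  tuple_measure lebesgue_plane n.

Definition vec (x : Cn R n) : 'cV[R[i]]_n :=
  \col_i ((tnth x i).1 +i* (tnth x i).2).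

Definition eucl_norm (x : Cn R n) : R :=
  Num.sqrt (\sum_(i < n) ((tnth x i).1 ^+ 2 + (tnth x i).2 ^+ 2)).

Definition normalize (x : Cn R n) : Cn R n :=
  [tuple ((tnth x i).1 / eucl_norm x, (tnth x i).2 / eucl_norm x) | i < n].

Definition punctured_ball : set (Cn R n) := [set x | 0 < eucl_norm x <= 1].

Lemma measurable_re i : measurable_fun setT (fun x : Cn R n => (tnth x i).1).
Proof.
by apply: (measurableT_comp measurable_fst); exact: measurable_tnth.
Qed.

Lemma measurable_im i : measurable_fun setT (fun x : Cn R n => (tnth x i).2).
Proof.
by apply: (measurableT_comp measurable_snd); exact: measurable_tnth.
Qed.

Lemma measurable_eucl_norm : measurable_fun setT eucl_norm.
Proof.
apply: (@measurableT_comp _ _ _ _ _ _ (@Num.sqrt R)).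
  by apply: continuous_measurable_fun; exact: sqrt_continuous.
apply: measurable_sum => i; apply: measurable_funD.
  by apply: measurable_funX; exact: measurable_re.
by apply: measurable_funX; exact: measurable_im.
Qed.

Lemma measurable_punctured_ball : measurable punctured_ball.
Proof.
rewrite (_ : punctured_ball = eucl_norm @^-1` `]0, 1]).
  by rewrite -[X in measurable X]setTI; apply: measurable_eucl_norm.
by apply/seteqP; split => x /=; rewrite in_itv.
Qed.

Lemma measurable_normalize : measurable_fun setT normalize.
Proof.
apply/measurable_fun_tnthP => i.
rewrite (_ : _ \o _ = fun x =>
    ((tnth x i).1 * (eucl_norm x)^-1, (tnth x i).2 * (eucl_norm x)^-1)); last first.
  by apply/funext => x /=; rewrite tnth_mktuple.
have mV : measurable_fun setT (fun x => (eucl_norm x)^-1).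
  rewrite (_ : (fun _ => _) = (fun x => eucl_norm x `^ (-1))).
    by apply: (measurableT_comp (measurable_powR (-1))); exact: measurable_eucl_norm.
  by apply/funext => x; rewrite powR_inv1// sqrtr_ge0.
apply/measurable_fun_pairP; split.
  by apply: measurable_funM => //; exact: measurable_re.
by apply: measurable_funM => //; exact: measurable_im.
Qed.

HB.instance Definition _ :=
  isMeasurableFun.Build _ _ _ _ normalize measurable_normalize.

(* Normalized surface measure: the surface measure of a Borel subset E of the  *)
(* sphere is proportional to the volume of the cone {r e | 0 < r <= 1, e in E}, *)
(* i.e. it is the image of the uniform probability of the ball under           *)
(* x |-> x / |x|. The Dirac mass is the fallback value of [mnormalize], which  *)
(* plays no role for 0 < n since the ball has then positive finite volume.     *)
Definition uniform_ball : probability (Cn R n) R :=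
  mnormalize (mrestr lebesgue_Cn measurable_punctured_ball)
    (dirac (nseq_tuple n (0, 0) : Cn R n)).

Definition sphere_measure : probability (Cn R n) R :=
  distribution uniform_ball normalize.

End sphere.

Section numerical_measure.
Variables (R : realType) (n : nat).

Definition inner (x y : 'cV[R[i]]_n) : R[i] := (y ^t* *m x) 0 0.

(* For Hermitian A the number <Ax, x> is real (see [hermitian_inner_real]).    *)
Definition quad_form (A : 'M[R[i]]_n) (x : Cn R n) : measurableTypeR R :=
  complex.Re (inner (A *m vec x) (vec x)).

Lemma hermitian_inner_real (A : 'M[R[i]]_n) (x : 'cV[R[i]]_n) :
  A \is hermsymmx -> complex.Im (inner (A *m x) x) = 0.
Proof.
move=> /is_hermitianmxP; rewrite expr0 scale1r => hA.
have : (inner (A *m x) x)^* = inner (A *m x) x.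
  have xK : (x ^t* ) ^t* = x by apply/matrixP => k l; rewrite !mxE conjCK.
  have BE : x ^t* *m (A *m x) = (x ^t* *m (A *m x)) ^t*.
    by rewrite !trmx_mul !map_mxM xK -hA mulmxA.
  by rewrite /inner [in RHS]BE [in RHS]mxE [in RHS]mxE.
case: (inner _ _) => a b [] /eqP; rewrite eq_sym -addr_eq0 -mulr2n.
by rewrite mulrn_eq0 => /eqP.
Qed.

Lemma measurable_quad_form (A : 'M[R[i]]_n) : measurable_fun setT (quad_form A).
Proof.
pose P (f : Cn R n -> R[i]) := measurable_fun setT (@complex.Re R \o f) /\
  measurable_fun setT (@complex.Im R \o f).
have Pvec i : P (fun x => vec x i 0).
  split.
    rewrite (_ : _ \o _ = fun x => (tnth x i).1); first exact: measurable_re.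
    by apply/funext => x /=; rewrite mxE.
  rewrite (_ : _ \o _ = fun x => (tnth x i).2); first exact: measurable_im.
  by apply/funext => x /=; rewrite mxE.
have Pconj f : P f -> P (fun x => (f x)^*).
  move=> [mr mi]; split.
    by rewrite (_ : _ \o _ = @complex.Re R \o f)//; apply/funext => x /=; case: (f x).
  rewrite (_ : _ \o _ = fun x => - (@complex.Im R \o f) x).
    exact: measurableT_comp.
  by apply/funext => x /=; case: (f x).
have Pcst c : P (fun=> c) by split; exact: measurable_cst.
have PM f g : P f -> P g -> P (fun x => f x * g x).
  move=> [fr fi] [gr gi]; split.
    rewrite (_ : _ \o _ = (fun x => (@complex.Re R \o f) x * (@complex.Re R \o g) x
                                  - (@complex.Im R \o f) x * (@complex.Im R \o g) x)).
      by apply: measurable_funB; exact: measurable_funM.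
    by apply/funext => x /=; case: (f x) (g x) => ? ? [].
  rewrite (_ : _ \o _ = (fun x => (@complex.Re R \o f) x * (@complex.Im R \o g) x
                                + (@complex.Im R \o f) x * (@complex.Re R \o g) x)).
    by apply: measurable_funD; exact: measurable_funM.
  by apply/funext => x /=; case: (f x) (g x) => ? ? [].
have Psum (F : 'I_n -> Cn R n -> R[i]) :
    (forall i, P (F i)) -> P (fun x => \sum_i F i x).
  move=> PF; split.
    rewrite (_ : _ \o _ = fun x => \sum_i (@complex.Re R \o F i) x).
      by apply: measurable_sum => i; case: (PF i).
    by apply/funext => x /=; rewrite raddf_sum.
  rewrite (_ : _ \o _ = fun x => \sum_i (@complex.Im R \o F i) x).
    by apply: measurable_sum => i; case: (PF i).
  by apply/funext => x /=; rewrite raddf_sum.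
have [] // : P (fun x => inner (A *m vec x) (vec x)).
rewrite (_ : (fun _ => _) = fun x => \sum_i
    (vec x i 0)^* * (\sum_j A i j * vec x j 0)); last first.
  apply/funext => x; rewrite /inner mxE; apply: eq_bigr => i _.
  by rewrite [in LHS]mxE [in LHS]mxE [(A *m _) _ _]mxE.
apply: (Psum (fun i x => (vec x i 0)^* * (\sum_j A i j * vec x j 0))) => i.
apply/PM; first exact/Pconj.
by apply: (Psum (fun j x => A i j * vec x j 0)) => j; exact: PM.
Qed.

HB.instance Definition _ (A : 'M[R[i]]_n) :=
  isMeasurableFun.Build _ _ _ _ (quad_form A) (measurable_quad_form A).

Definition numerical_measure (A : 'M[R[i]]_n) :
    probability (measurableTypeR R) R :=
  distribution (sphere_measure R n) (quad_form A).

Definition numerical_density (A : 'M[R[i]]_n) (x : R) : R :=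
  fine (('d (charge_of_finite_measure (numerical_measure A))
         '/d (@lebesgue_measure R)) x).

End numerical_measure.

Section spline.
Variables (R : realType) (n : nat).

Definition distinct_knots : set 'rV[R]_n := [set l : 'rV[R]_n | injective (l 0)].

Definition divdiff_distinct (g : R -> R) (l : 'rV[R]_n) : R :=
  \sum_(j < n) g (l 0 j) / \prod_(k < n | k != j) (l 0 j - l 0 k).

(* For repeated knots, the extension by continuity in the knots.               *)
Definition divdiff (l : 'rV[R]_n) (g : R -> R) : R :=
  if `[< distinct_knots l >] then divdiff_distinct g l
  else lim (divdiff_distinct g @ within distinct_knots (nbhs l)).

(* Not [Num.max 0 (y - x) ^+ d], because 0 ^+ 0 = 1. *)
Definition truncated_power (d : nat) (x y : R) : R :=
  if x < y then (y - x) ^+ d else 0.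

Definition Bspline (l : 'rV[R]_n) (x : R) : R :=
  n.-1%:R * divdiff l (truncated_power n.-2 x).

End spline.

(* Main.v *)
(* Write A = U^* D U. Lebesgue measure m on C^n is invariant under U because, for
   every translation-invariant measure, m(U^-1 E) m(B) = m(U^-1 B) m(-E); take for
   B the ball. As z |-> |z|^2 maps Lebesgue measure on C to a multiple of Lebesgue
   measure on [0, +oo[, the tail mu_A ]x, +oo[ is the proportion tail(lambda - x) of
   the simplex {t >= 0, sum t <= 1} on which sum_j a_j t_j > 0, a_j = lambda_j - x.

   If a_i > 0 > a_j, cutting the simplex along a_i t_i + a_j t_j = 0 and shearing each
   half gives (a_i - a_j) tail(a) = a_i tail(a with a_j := 0) - a_j tail(a with a_i := 0).
   This recursion makes tail a rational function of a near every point without zero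
   entry, also for repeated entries, whence continuity in the knots; it identifies
   tail with a divided difference of a truncated power for distinct knots; and it
   yields - d/dx tail(lambda - x) = (n - 1) (tail(without j) - tail(without i)) /
   (lambda_i - lambda_j), which is the B-spline. As mu_A has no atoms, the density
   formula on knot-free segments extends to all Borel sets. *)
From HB Require Import structures.
Require Import Defs.
From mathcomp Require Import all_boot all_order all_algebra.
From mathcomp Require Import complex.
From mathcomp Require Import all_classical all_reals all_analysis.
From mathcomp Require Import measurable_realfun ring lra.

Set Implicit Arguments.
Unset Strict Implicit.
Unset Printing Implicit Defensive.

Import Order.TTheory GRing.Theory Num.Theory.
Import numFieldNormedType.Exports.
Local Open Scope classical_set_scope.
Local Open Scope ring_scope.
Local Open Scope complex_scope.

(** * Lebesgue integrals on the half-line *)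

(** Neither pi nor the volume 1 / n! of the simplex is ever computed: [tail] is a quotient, and both
    the volume of the simplex and the area of the unit disk, kept as an unevaluated constant, cancel
    in the normalization. Of a point [t] of the simplex only [\sum_j a_j t_j] and [\sum_j t_j]
    matter. A pair [w] carries these two running sums, and volumes become iterated integrals along
    the directions [(a_j, 1)] of the plane. By Tonelli the directions may be permuted, so any two of
    them can be brought to the front, where a shear of the plane suffices. The obstacle is repeated
    knots: there the divided difference is a limit over nearby distinct knots, and formulas dividing
    by all differences of knots break down. Nonscalarity supplies two indices with different knots.
    Written with these two, the spline has the single denominator [lambda_i - lambda_j], and its
    numerator consists of tails of subsets of the knots, which are continuous in the knots as long
    as the evaluation point is not one of them. *)

Section line_integrals.
Context {R : realType}.
Local Notation mu := (@lebesgue_measure R).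
Local Notation T := (measurableTypeR R).
Local Open Scope ereal_scope.

Lemma measurable_affine (s c : R) : measurable_fun setT (fun t : T => (s * t + c)%R : T).
Proof. by apply: measurable_funD => //; exact: measurable_funM. Qed.

(** Lebesgue measure is determined by its values on the intervals []a, b]], and [s] times its image
    under the affine map has the same values there. *)
Lemma lebesgue_integral_affine (s c : R) (f : T -> \bar R) : (0 < s)%R ->
  measurable_fun setT f -> (forall x, 0 <= f x) ->
  \int[mu]_x f (s * x + c)%R = s^-1%:E * \int[mu]_x f x.
Proof.
move=> s0 mf f0.
have mphi := measurable_affine s c.
pose sn : {nonneg R} := NngNum (ltW s0).
have E A : measurable A -> mu A = mscale sn (pushforward mu (fun t : T => (s * t + c)%R : T)) A.
  apply: (@lebesgue_measure_unique R (mscale sn (pushforward mu (fun t : T => (s * t + c)%R : T)))).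
  move=> X /ocitvP [->|[[a b] /= ab ->]]; first by rewrite !measure0.
  rewrite /mscale /= /pushforward.
  have -> : (fun t => s * t + c)%R @^-1` `]a, b]%classic =
      `]((a - c) / s)%R, ((b - c) / s)%R]%classic.
    apply/seteqP; split => x /=; rewrite !in_itv /= ltr_pdivrMr// ler_pdivlMr//;
    by rewrite ltrBlDr lerBrDr mulrC.
  rewrite !lebesgue_measure_itv /= !lte_fin ab.
  rewrite ltr_pM2r ?invr_gt0// ltrD2r ab -!EFinD -EFinM; congr EFin.
  by field; rewrite gt_eqF.
rewrite [in RHS](eq_measure_integral
  (mscale sn (pushforward mu (fun t : T => (s * t + c)%R : T)))); last first.
  by move=> A mA _; exact: E.
rewrite ge0_integral_mscale//= ge0_integral_pushforward//=.
by rewrite muleA -EFinM mulVf ?gt_eqF// mul1e.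
Qed.

Lemma lebesgue_integral_shift (c : R) (f : T -> \bar R) :
  measurable_fun setT f -> (forall x, 0 <= f x) ->
  \int[mu]_x f (x + c)%R = \int[mu]_x f x.
Proof.
move=> mf f0; rewrite -[RHS]mul1e -[X in X%:E](invr1 R).
rewrite -(@lebesgue_integral_affine _ c)//.
by apply: eq_integral => x _; rewrite mul1r.
Qed.

Lemma lebesgue_integral_scale (s : R) (f : T -> \bar R) : (0 < s)%R ->
  measurable_fun setT f -> (forall x, 0 <= f x) ->
  \int[mu]_x f (s * x)%R = s^-1%:E * \int[mu]_x f x.
Proof.
move=> s0 mf f0; rewrite -(@lebesgue_integral_affine _ 0)//.
by apply: eq_integral => x _; rewrite addr0.
Qed.

(** Used to discard ties: the origin of a ray, the common edge of two pieces of a quadrant, the zero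
    of a nonconstant affine function. *)
Lemma eq_integral_except1 (r : R) (f g : T -> \bar R) :
  measurable_fun setT f -> measurable_fun setT g ->
  (forall x, x != r -> f x = g x) -> \int[mu]_x f x = \int[mu]_x g x.
Proof.
move=> mf mg fg; apply: ae_eq_integral => //.
exists [set r]; split => //; first exact: lebesgue_measure_set1.
by move=> x /=; apply: contra_notP => /eqP xr _; exact: fg.
Qed.

End line_integrals.

(** * Integration along rays of the plane *)

Section directional_integral.
Context {R : realType}.
Local Notation mu := (@lebesgue_measure R).
Local Notation T := (measurableTypeR R).
Local Open Scope ereal_scope.

(** The integral of [h] along the ray from [w] in the direction [(a, 1)]. *)
Definition dirint (a : R) (h : T * T -> \bar R) (w : T * T) : \bar R :=
  \int[mu]_t (if (0 <= t)%R then h (w.1 + a * t, w.2 + t)%R else 0).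

Lemma dirint_ge0 a h w : (forall w, 0 <= h w) -> 0 <= dirint a h w.
Proof. by move=> h0; apply: integral_ge0 => t _; case: ifP. Qed.

Lemma measurable_fun_pos d (X : measurableType d) (f : X -> T) (g : X -> \bar R) :
  measurable_fun setT f -> measurable_fun setT g ->
  measurable_fun setT (fun x => if (0 <= f x)%R then g x else 0).
Proof.
move=> mf mg; apply: measurable_fun_ifT => //.
by apply: measurable_fun_ler => //.
Qed.

Lemma measurable_dirint a h : (forall w, 0 <= h w) ->
  measurable_fun setT h -> measurable_fun setT (dirint a h).
Proof.
move=> h0 mh.
pose f (z : (T * T) * T) : \bar R :=
  if (0 <= z.2)%R then h (z.1.1 + a * z.2, z.1.2 + z.2)%R else 0.
apply: (@measurable_fun_fubini_tonelli_F _ _ _ _ _ mu f).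
  apply: measurable_fun_pos; first exact: measurable_snd.
  apply: (measurableT_comp mh); apply: measurable_fun_pair.
    apply: measurable_funD; first by do 2 apply: measurableT_comp => //.
    by apply: measurable_funM => //; exact: measurable_snd.
  apply: measurable_funD; last exact: measurable_snd.
  by do 2 apply: measurableT_comp => //.
by move=> z; rewrite /f; case: ifP.
Qed.

End directional_integral.

Lemma measurable_fun_proj1 d d1 d2 (X : measurableType d) (Y : measurableType d1)
    (Z : measurableType d2) (f : X -> Y * Z) :
  measurable_fun setT f -> measurable_fun setT (fun x => (f x).1).
Proof. exact: (measurableT_comp measurable_fst). Qed.

Lemma measurable_fun_proj2 d d1 d2 (X : measurableType d) (Y : measurableType d1)
    (Z : measurableType d2) (f : X -> Y * Z) :
  measurable_fun setT f -> measurable_fun setT (fun x => (f x).2).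
Proof. exact: (measurableT_comp measurable_snd). Qed.

Ltac measfun := repeat first
  [ exact: measurable_id | exact: measurable_cst | exact: measurable_fst
  | exact: measurable_snd
  | apply: measurable_fun_pair | apply: measurable_funB
  | apply: measurable_funD | apply: measurable_funM
  | apply: measurable_fun_proj1 | apply: measurable_fun_proj2 ].

Section dirint_theory.
Context {R : realType}.
Local Notation mu := (@lebesgue_measure R).
Local Notation T := (measurableTypeR R).
Local Open Scope ereal_scope.

Lemma dirintC (a b : R) h w : (forall w, 0 <= h w) -> measurable_fun setT h ->
  dirint a (dirint b h) w = dirint b (dirint a h) w.
Proof.
move=> h0 mh; rewrite /dirint.
pose f (z : T * T) : \bar R := if (0 <= z.1)%R then if (0 <= z.2)%R then
  h (w.1 + a * z.1 + b * z.2, w.2 + z.1 + z.2)%R else 0 else 0.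
transitivity (\int[mu]_t \int[mu]_s f (t, s)).
  apply: eq_integral => t _; rewrite /f /=; case: ifP => // t0.
  by rewrite integral0.
rewrite fubini_tonelli; last 2 first.
- do 2 (apply: measurable_fun_pos; first by measfun).
  by apply: (measurableT_comp mh); measfun.
- by move=> z; rewrite /f; do 2 case: ifP => //.
apply: eq_integral => s _; rewrite /f /=; case: ifP => // s0.
  apply: eq_integral => t _; case: ifP => // t0.
  by congr (h (_, _)); rewrite addrAC.
by rewrite integral0_eq// => t _; case: ifP.
Qed.

(* Change of variables [t = t' + (q / p) s], then [s' = (1 + q / p) s]. *)
Lemma half_quadrant_shear (p q : R) (h : T * T -> \bar R) :
  (0 < p)%R -> (0 < q)%R -> (forall w, 0 <= h w) -> measurable_fun setT h ->
  \int[mu]_s (if (0 <= s)%R then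
    \int[mu]_t (if (q * s <= p * t)%R then h (p * t - q * s, t + s)%R else 0)
    else 0) =
  (p / (p + q))%:E * \int[mu]_t (if (0 <= t)%R then
    \int[mu]_s (if (0 <= s)%R then h (p * t, t + s)%R else 0) else 0).
Proof.
move=> p0 q0 h0 mh.
have pq0 : (0 < 1 + q / p)%R by rewrite addr_gt0// divr_gt0.
pose g (z : T * T) : \bar R := if (0 <= z.1)%R then
  if (0 <= z.2)%R then h (p * z.2, z.2 + (1 + q / p) * z.1)%R else 0 else 0.
transitivity (\int[mu]_s \int[mu]_t g (s, t)).
  apply: eq_integral => s _; rewrite /g /=; case: ifP => s0; last first.
    by rewrite integral0.
  rewrite -[in RHS](@lebesgue_integral_shift _ (- (q / p * s))); last 2 first.
  - apply: measurable_fun_pos; first by measfun.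
    by apply: (measurableT_comp mh); measfun.
  - by move=> x; case: ifP.
  apply: eq_integral => t _; rewrite -[LHS]/(if _ then _ else _).
  have -> : (0 <= t - q / p * s)%R = (q * s <= p * t)%R.
    by rewrite subr_ge0 mulrAC ler_pdivrMr// [(t * p)%R]mulrC.
  case: ifP => // _; congr (h (_, _)); field; rewrite gt_eqF//.
rewrite fubini_tonelli; last 2 first.
- do 2 (apply: measurable_fun_pos; first by measfun).
  by apply: (measurableT_comp mh); measfun.
- by move=> z; rewrite /g; do 2 case: ifP => //.
have mk t : measurable_fun setT (fun s : T => if (0 <= s)%R then h (p * t, t + s)%R else 0).
  apply: measurable_fun_pos; first by measfun.
  by apply: (measurableT_comp mh); measfun.
have k0 t s : 0 <= (if (0 <= s)%R then h (p * t, t + s)%R else 0) by case: ifP.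
rewrite -ge0_integralZl//; last 3 first.
- apply: measurable_fun_pos; first by measfun.
  apply: (@measurable_fun_fubini_tonelli_F _ _ _ _ _ mu
    (fun z : T * T => if (0 <= z.2)%R then h (p * z.1, z.1 + z.2)%R else 0)).
    apply: measurable_fun_pos; first by measfun.
    by apply: (measurableT_comp mh); measfun.
  by move=> z; case: ifP.
- by move=> t _; case: ifP => // _; exact: integral_ge0.
- by rewrite lee_fin divr_ge0// ltW// addr_gt0.
apply: eq_integral => t _; rewrite /g /=; case: ifP => t0; last first.
  by rewrite mule0 integral0_eq// => s _; case: ifP.
have -> : (p / (p + q) = (1 + q / p)^-1)%R by field; rewrite !gt_eqF// addr_gt0.
rewrite -(lebesgue_integral_scale pq0)//.
by apply: eq_integral => s _; rewrite pmulr_rge0.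
Qed.

(** The ray [(0, 1)] cuts the cone spanned by [(p, 1)] and [(- q, 1)] into two cones. The weights
    are the ratios of the determinants [p], [q] and [p + q] of the three pairs of directions. *)
Lemma dirint_opposite (p q : R) (h : T * T -> \bar R) w :
  (0 < p)%R -> (0 < q)%R -> (forall w, 0 <= h w) -> measurable_fun setT h ->
  dirint p (dirint (- q) h) w =
  (p / (p + q))%:E * dirint p (dirint 0 h) w +
  (q / (p + q))%:E * dirint 0 (dirint (- q) h) w.
Proof.
move=> p0 q0 h0 mh.
pose f (z : T * T) : \bar R := if (0 <= z.1)%R then if (0 <= z.2)%R then
  h (w.1 + (p * z.1 - q * z.2), w.2 + (z.1 + z.2))%R else 0 else 0.
(* The quadrant is cut along [p t = q s] and both parts are sheared onto it. *)
pose f1 (z : T * T) : \bar R := if (q * z.2 <= p * z.1)%R then f z else 0.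
pose f2 (z : T * T) : \bar R := if (p * z.1 <= q * z.2)%R then f z else 0.
have f_0 z : 0 <= f z by rewrite /f; do 2 case: ifP => //.
have f10 z : 0 <= f1 z by rewrite /f1; case: ifP => //.
have f20 z : 0 <= f2 z by rewrite /f2; case: ifP => //.
have mf : measurable_fun setT f.
  do 2 (apply: measurable_fun_pos; first by measfun).
  by apply: (measurableT_comp mh); measfun.
have mf1 : measurable_fun setT f1.
  by apply: measurable_fun_ifT => //; apply: measurable_fun_ler; measfun.
have mf2 : measurable_fun setT f2.
  by apply: measurable_fun_ifT => //; apply: measurable_fun_ler; measfun.
have ms (k : T * T -> \bar R) (mk : measurable_fun setT k) (t : T) :
    measurable_fun setT (fun s : T => k (t, s) : \bar R).
  by apply: (measurableT_comp mk); measfun.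
have E1 : dirint p (dirint (- q) h) w = \int[mu]_t \int[mu]_s f (t, s).
  apply: eq_integral => t _; rewrite /f /=; case: ifP => // t0; last by rewrite integral0.
  apply: eq_integral => s _ /=; case: ifP => // s0.
  by congr (h (_, _)); ring.
rewrite E1.
transitivity (\int[mu]_t \int[mu]_s f1 (t, s) + \int[mu]_t \int[mu]_s f2 (t, s)).
  rewrite -ge0_integralD//; last 4 first.
  - by move=> t _; exact: integral_ge0.
  - exact: (@measurable_fun_fubini_tonelli_F _ _ _ _ _ mu f1).
  - by move=> t _; exact: integral_ge0.
  - exact: (@measurable_fun_fubini_tonelli_F _ _ _ _ _ mu f2).
  apply: eq_integral => t _; rewrite -ge0_integralD//; [|exact: ms|exact: ms].
  (* Both pieces contain the line [p t = q s], which meets each slice in one point. *)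
  apply: (@eq_integral_except1 _ (p * t / q)%R).
  - exact: ms.
  - by apply: emeasurable_funD; exact: ms.
  - move=> s; rewrite /f1 /f2 /=.
    case: (ltgtP (q * s)%R (p * t)%R) => [_|_|<-]; rewrite ?adde0 ?add0e//.
    by rewrite mulrC mulKf ?eqxx// gt_eqF.
congr (_ + _).
- rewrite (fubini_tonelli f1 mf1 f10).
  transitivity (\int[mu]_s (if (0 <= s)%R then
    \int[mu]_t (if (q * s <= p * t)%R then h (w.1 + (p * t - q * s), w.2 + (t + s))%R else 0)
    else 0)).
    apply: eq_integral => s _; rewrite /f1 /f /=.
    case: ifP => s0; last first.
      by rewrite integral0_eq// => t _; do 2 case: ifP => //.
    apply: eq_integral => t _; case: ifP => // qspt; case: ifPn => //.
    by rewrite -(pmulr_rge0 _ p0) (le_trans _ qspt)// mulr_ge0// ltW.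
  etransitivity.
    apply: (half_quadrant_shear (h := fun z => h (w.1 + z.1, w.2 + z.2)%R) p0 q0) => [z|].
      exact: h0.
    by apply: (measurableT_comp mh); measfun.
  apply: (congr1 (mule _)); apply: eq_integral => t _; case: ifP => [_|//].
  apply: eq_integral => s _; case: ifP => [_|//].
  by congr (h (_, _)); rewrite /=; ring.
- transitivity (\int[mu]_t (if (0 <= t)%R then
    \int[mu]_s (if (p * t <= q * s)%R then h (w.1 - (q * s - p * t), w.2 + (s + t))%R else 0)
    else 0)).
    apply: eq_integral => t _; rewrite /f2 /f /=.
    case: ifP => t0; last first.
      by rewrite integral0_eq// => s _; case: ifP.
    apply: eq_integral => s _; case: ifP => // ptqs; case: ifPn => [_|].
      by congr (h (_, _)); ring.
    by rewrite -(pmulr_rge0 _ q0) (le_trans _ ptqs)// mulr_ge0// ltW.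
  etransitivity.
    apply: (half_quadrant_shear (h := fun z => h (w.1 - z.1, w.2 + z.2)%R) q0 p0) => [z|].
      exact: h0.
    by apply: (measurableT_comp mh); measfun.
  rewrite (dirintC _ _ _ h0 mh) [(q + p)%R]addrC.
  apply: (congr1 (mule _)); apply: eq_integral => t _; case: ifP => [_|//].
  apply: eq_integral => s _; case: ifP => [_|//].
  by congr (h (_, _)); rewrite /=; ring.
Qed.

Lemma dirint_pos_irr (a : R) (h k : T * T -> \bar R) w :
  measurable_fun setT h -> measurable_fun setT k ->
  (forall t, (0 < t)%R -> h (w.1 + a * t, w.2 + t)%R = k (w.1 + a * t, w.2 + t)%R) ->
  dirint a h w = dirint a k w.
Proof.
move=> mh mk hk; apply: (@eq_integral_except1 _ 0).
- by apply: measurable_fun_pos; [|apply: (measurableT_comp mh)]; measfun.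
- by apply: measurable_fun_pos; [|apply: (measurableT_comp mk)]; measfun.
- by move=> t t0; case: ifP => // t1; apply: hk; rewrite lt_neqAle eq_sym t0.
Qed.

End dirint_theory.

(** * Iterated integrals along directions *)

Section iterated_dirint.
Context {R : realType}.
Local Notation mu := (@lebesgue_measure R).
Local Notation T := (measurableTypeR R).
Local Open Scope ereal_scope.

(* The integral of [h (w.1 + \sum_i s_i t_i, w.2 + \sum_i t_i)] over [t] in
   the orthant [0, +oo[ ^ (size s). *)
Definition dirints (s : seq R) (h : T * T -> \bar R) : T * T -> \bar R :=
  foldr dirint h s.

Lemma dirints_ge0 s h : (forall w, 0 <= h w) -> forall w, 0 <= dirints s h w.
Proof. by move=> h0; elim: s => //= a s IH w; exact: dirint_ge0. Qed.

Lemma measurable_dirints s h : (forall w, 0 <= h w) ->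
  measurable_fun setT h -> measurable_fun setT (dirints s h).
Proof.
move=> h0 mh; elim: s => //= a s IH; apply: measurable_dirint => //.
exact: dirints_ge0.
Qed.

Lemma le_dirint (a : R) (h k : T * T -> \bar R) w :
  (forall w, 0 <= h w) -> (forall w, h w <= k w) ->
  measurable_fun setT h -> measurable_fun setT k ->
  dirint a h w <= dirint a k w.
Proof.
move=> h0 hk mh mk; apply: ge0_le_integral => //.
- by move=> t _; case: ifP.
- by apply: measurable_fun_pos; [|apply: (measurableT_comp mh)]; measfun.
- by apply: measurable_fun_pos; [|apply: (measurableT_comp mk)]; measfun.
- by move=> t _; case: ifP.
Qed.

Lemma le_dirints s (h k : T * T -> \bar R) w :
  (forall w, 0 <= h w) -> (forall w, h w <= k w) ->
  measurable_fun setT h -> measurable_fun setT k ->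
  dirints s h w <= dirints s k w.
Proof.
move=> h0 hk mh mk; elim: s w => //= a s IH w; apply: le_dirint => //.
- exact: dirints_ge0.
- exact: measurable_dirints.
- by apply: measurable_dirints => // v; exact: le_trans (hk v).
Qed.

Section permutation.
Variable h : T * T -> \bar R.
Hypotheses (h0 : forall w, 0 <= h w) (mh : measurable_fun setT h).

Lemma dirints_catCA a s1 s2 :
  dirints (s1 ++ a :: s2) h = dirint a (dirints (s1 ++ s2) h).
Proof.
elim: s1 => //= b s1 ->; apply/funext => w.
apply: dirintC; [exact: dirints_ge0|exact: measurable_dirints].
Qed.

Lemma perm_dirints s1 s2 : perm_eq s1 s2 -> dirints s1 h = dirints s2 h.
Proof.
elim: s1 s2 => [|a s1 IH] s2; first by move=> /perm_size/esym/size0nil ->.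
move=> ps; have as2 : a \in s2 by rewrite -(perm_mem ps) mem_head.
case/splitPr: as2 ps => l r ps; rewrite dirints_catCA /= (IH (l ++ r))//.
by rewrite -(perm_cons a) (perm_trans ps)// -cat1s perm_catCA.
Qed.

End permutation.

(** The inequality at 0 is strict because the ball is punctured. *)
Definition in_unit (w : T * T) : \bar R :=
  if (0 < w.2 <= 1)%R then 1 else 0.

Definition pos_in_unit (w : T * T) : \bar R :=
  if (0 < w.1)%R then in_unit w else 0.

Definition null_in_unit (w : T * T) : \bar R :=
  if (w.1 == 0)%R then in_unit w else 0.

Lemma in_unit_ge0 w : 0 <= in_unit w.
Proof. by rewrite /in_unit; case: ifP. Qed.

Lemma pos_in_unit_ge0 w : 0 <= pos_in_unit w.
Proof. by rewrite /pos_in_unit; case: ifP => // _; exact: in_unit_ge0. Qed.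

Lemma null_in_unit_ge0 w : 0 <= null_in_unit w.
Proof. by rewrite /null_in_unit; case: ifP => // _; exact: in_unit_ge0. Qed.

Lemma measurable_in_unit : measurable_fun setT in_unit.
Proof.
apply: measurable_fun_ifT => //; apply: measurable_and.
  by apply: measurable_fun_ltr; measfun.
by apply: measurable_fun_ler; measfun.
Qed.

Lemma measurable_pos_in_unit : measurable_fun setT pos_in_unit.
Proof.
apply: measurable_fun_ifT => //; last exact: measurable_in_unit.
by apply: measurable_fun_ltr; measfun.
Qed.

Lemma measurable_null_in_unit : measurable_fun setT null_in_unit.
Proof.
apply: measurable_fun_ifT => //; last exact: measurable_in_unit.
by apply: measurable_fun_eqr; measfun.
Qed.

Hint Resolve in_unit_ge0 pos_in_unit_ge0 null_in_unit_ge0 measurable_in_unit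
  measurable_pos_in_unit measurable_null_in_unit : core.

(** [in_unit] reads only the second coordinate, which grows at unit speed along every direction.
    Hence the volume of the whole simplex does not depend on the coefficients. *)
Lemma eq_dirints_in_unit s s' w w' : size s = size s' -> w.2 = w'.2 ->
  dirints s in_unit w = dirints s' in_unit w'.
Proof.
elim: s s' w w' => [|a s IH] [|b s']//= w w'; first by rewrite /in_unit => _ ->.
move=> [ss] ww; apply: eq_integral => t _; case: ifP => // _.
by apply: IH => //=; rewrite ww.
Qed.

Lemma dirints_pos_in_unit s w : all (>= 0)%R s -> (0 < w.1)%R ->
  dirints s pos_in_unit w = dirints s in_unit w.
Proof.
elim: s w => [|a s IH] w /=; first by rewrite /pos_in_unit => _ ->.
move=> /andP[a0 s0] w0; apply: eq_integral => t _; case: ifP => // t0.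
by rewrite IH//= ltr_wpDr// mulr_ge0.
Qed.

(** Moved to the outermost integral, a positive direction makes the first coordinate positive for
    all [t > 0], and [t = 0] is negligible. *)
Lemma dirints_pos_in_unitT s w : all (>= 0)%R s -> has (> 0)%R s -> (0 <= w.1)%R ->
  dirints s pos_in_unit w = dirints s in_unit w.
Proof.
move=> s0 /hasP[p + p0]; move=> /perm_to_rem ps w0.
rewrite !(perm_dirints _ _ ps)//=.
apply: dirint_pos_irr; [exact: measurable_dirints|exact: measurable_dirints|].
move=> t t0; apply: dirints_pos_in_unit => /=.
  by apply/allP => x /mem_rem xs; exact: (allP s0).
by rewrite ltr_wpDl// mulr_gt0.
Qed.

Lemma dirints_pos_in_unit0 s w : all (<= 0)%R s -> (w.1 <= 0)%R ->
  dirints s pos_in_unit w = 0.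
Proof.
elim: s w => [|a s IH] w /=; first by rewrite /pos_in_unit ltNge => _ ->.
move=> /andP[a0 s0] w0; apply: integral0_eq => t _; case: ifP => // t0.
by rewrite IH//= -(addr0 0%R) lerD// mulr_le0_ge0.
Qed.

(** A nonzero direction is moved to the innermost integral: its ray meets the line [w.1 = 0] in at
    most one point. This is why the numerical measure has no atoms. *)
Lemma dirints_null_in_unit s w : has (predC1 0%R) s -> dirints s null_in_unit w = 0.
Proof.
move=> /hasP[p + /= p0]; move=> /perm_to_rem; rewrite perm_sym.
move=> ps; rewrite -(perm_dirints _ _ ps)//; move: ps => _.
rewrite (@perm_dirints _ _ _ _ (rcons (rem p s) p))//; last first.
  by rewrite perm_sym perm_rcons.
rewrite /dirints foldr_rcons -/(dirints _ _).
have -> : dirint p null_in_unit = cst 0.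
  apply/funext => v; rewrite -[RHS](@integral0 _ T R mu setT).
  apply: (@eq_integral_except1 _ (- v.1 / p)%R).
  - by apply: measurable_fun_pos; [|apply: (measurableT_comp measurable_null_in_unit)]; measfun.
  - exact: measurable_cst.
  - move=> t tp; case: ifP => // t0; rewrite /null_in_unit /=; case: ifPn => //.
    rewrite addrC addr_eq0 => /eqP pt; move: tp; rewrite -pt.
    by rewrite mulrC mulKf ?eqxx.
elim: (rem p s) w => //= a s' IH w; apply: integral0_eq => t _.
by case: ifP => // _; exact: IH.
Qed.

(** From a nonnegative height, a ray leaves the strip of height 1 within time 1. This bound makes
    [simplex_volume] finite. *)
Lemma dirints_in_unit_le1 s w : (0 <= w.2)%R ->
  dirints s in_unit w <= if (w.2 <= 1)%R then 1 else 0.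
Proof.
elim: s w => [|a s IH] w w0 /=.
  by rewrite /in_unit; case: ifP => [/andP[_ ->]//|_]; case: ifP.
apply: (@le_trans _ _
  (\int[mu]_t (if (w.2 <= 1)%R then (\1_(`[0, 1]%classic : set T) t)%:E else 0))).
  apply: ge0_le_integral => //.
  - by move=> t _; case: ifP => // _; exact: dirints_ge0.
  - by apply: measurable_fun_pos; [|apply: measurableT_comp;[exact: measurable_dirints|]]; measfun.
  - by case: (w.2 <= 1)%R => //; apply/measurable_EFinP.
  move=> t _; case: ifP => [t0|_]; last by case: ifP.
  apply: (le_trans (IH _ _)); rewrite /= ?addr_ge0//.
  case: ifPn => [wt|_]; last by case: ifP.
  rewrite (le_trans _ wt) ?lerDl// indicE mem_set//= in_itv /= t0/=.
  by rewrite (le_trans _ wt)// lerDr.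
case: (w.2 <= 1)%R; last by rewrite integral0.
by rewrite integral_indic// setIT /= lebesgue_measure_itv /= lte_fin ltr01 oppr0 adde0.
Qed.

(** For the positivity of [simplex_volume]. Each direction gets half of the remaining height [e],
    half being left to the base point. Height 0 is allowed only if some direction is left, since
    [in_unit] vanishes there and one step [t > 0] leads away from it. *)
Lemma dirints_in_unit_lb s : exists c e : R, [/\ (0 < c)%R, (0 < e)%R &
  forall w, (0 < w.2)%R || (s != [::]) && (0 <= w.2)%R -> (w.2 <= e)%R ->
    c%:E <= dirints s in_unit w].
Proof.
elim: s => [|a s [c [e [c0 e0 IH]]]].
  exists 1%R, 1%R; split => // w /orP[w0 w1|//]; rewrite /= /in_unit w0 w1//.
exists (c * (e / 2))%R, (e / 2)%R; split => [||w w0 we].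
- by rewrite mulr_gt0// divr_gt0.
- by rewrite divr_gt0.
have {}w0 : (0 <= w.2)%R by case/orP: w0 => //= /ltW.
apply: (@le_trans _ _ (\int[mu]_t (c%:E * (\1_(`]0, (e / 2)%R]%classic : set T) t)%:E))).
  rewrite ge0_integralZl//; last 2 first.
    exact/measurable_EFinP.
    by rewrite lee_fin ltW.
  rewrite integral_indic// setIT /= lebesgue_measure_itv /= lte_fin.
  by rewrite divr_gt0// oppr0 adde0.
apply: ge0_le_integral => //.
- by move=> t _; rewrite mule_ge0// lee_fin// ltW.
- by apply: emeasurable_funM => //; apply/measurable_EFinP.
- by apply: measurable_fun_pos; [|apply: measurableT_comp;[exact: measurable_dirints|]]; measfun.
move=> t _; rewrite indicE; case: (boolP (_ \in _)) => [|_]; last first.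
  by rewrite mule0; case: ifP => // _; exact: dirints_ge0.
rewrite inE /= in_itv /= mule1 => /andP[t0 te].
rewrite (ltW t0); apply: IH => /=; first by rewrite ltr_wpDl.
by rewrite (le_trans (lerD we te))// -splitr.
Qed.

End iterated_dirint.

(** * Tail proportions of the simplex *)

Section tail_fraction.
Context {R : realType} {n : nat}.
Local Notation T := (measurableTypeR R).
Implicit Types a : 'I_n -> R.

(* The volume of the [t] in the simplex [0 < \sum_j t_j <= 1] of the nonnegative
   orthant such that [0 < \sum_j a_j t_j]. *)
Definition tail_volume a : \bar R :=
  dirints [seq a j | j <- enum 'I_n] (@pos_in_unit R) (0, 0).

Definition simplex_volume : \bar R := dirints (nseq n 0) (@in_unit R) (0, 0).

Definition tail a : R := fine (tail_volume a) / fine simplex_volume.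

Lemma dirints_simplex_volume a :
  dirints [seq a j | j <- enum 'I_n] (@in_unit R) (0, 0) = simplex_volume.
Proof. by apply: eq_dirints_in_unit => //; rewrite size_map size_nseq size_enum_ord. Qed.

Lemma simplex_volume_fin : simplex_volume \is a fin_num.
Proof.
rewrite ge0_fin_numE; last exact/dirints_ge0/in_unit_ge0.
apply: le_lt_trans (ltry 1); apply: le_trans (dirints_in_unit_le1 _ _) _ => //=.
by rewrite ler01.
Qed.

Lemma simplex_volume_gt0 : (0 < n)%N -> 0 < fine simplex_volume.
Proof.
move=> n0; apply: fine_gt0.
rewrite -ge0_fin_numE ?simplex_volume_fin ?andbT; last exact/dirints_ge0/in_unit_ge0.
have [c [e [c0 e0 +]]] := @dirints_in_unit_lb R (nseq n 0).
move=> /(_ (0, 0)) /= ce; apply: lt_le_trans (ce _ _); rewrite ?lte_fin ?(ltW e0)//.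
by rewrite lexx andbT; case: (n) n0 => //= m _; rewrite orbT.
Qed.

Lemma tail_volume_le a : (tail_volume a <= simplex_volume)%E.
Proof.
rewrite -(dirints_simplex_volume a); apply: le_dirints.
- exact: pos_in_unit_ge0.
- by move=> w; rewrite /pos_in_unit; case: ifP => // _; exact: in_unit_ge0.
- exact: measurable_pos_in_unit.
- exact: measurable_in_unit.
Qed.

Lemma tail_volume_fin a : tail_volume a \is a fin_num.
Proof.
rewrite ge0_fin_numE; last exact/dirints_ge0/pos_in_unit_ge0.
by rewrite (le_lt_trans (tail_volume_le a))// ltey_eq simplex_volume_fin.
Qed.

Lemma tail_all_pos a : (forall i, 0 <= a i) -> (exists i, 0 < a i) -> tail a = 1.
Proof.
move=> a0 [i ai]; rewrite /tail /tail_volume dirints_pos_in_unitT//; last 2 first.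
- by apply/allP => _ /mapP[j _ ->].
- by apply/hasP; exists (a i) => //; apply/mapP; exists i; rewrite ?mem_enum.
by rewrite dirints_simplex_volume divff// gt_eqF// simplex_volume_gt0// (leq_trans _ (ltn_ord i)).
Qed.

Lemma tail_all_neg a : (forall i, a i <= 0) -> tail a = 0.
Proof.
move=> a0; rewrite /tail /tail_volume dirints_pos_in_unit0 ?mul0r//.
by apply/allP => _ /mapP[j _ ->]; exact: a0.
Qed.

Lemma tail_volume_front a i j : i != j ->
  tail_volume a = dirints (a i :: a j :: [seq a k | k <- enum 'I_n & (k != i) && (k != j)])
    (@pos_in_unit R) (0, 0).
Proof.
move=> ij; apply: (congr1 (fun f => f (0, 0))).
apply: perm_dirints; [exact: pos_in_unit_ge0|exact: measurable_pos_in_unit|].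
rewrite -!map_cons; apply: perm_map; apply: uniq_perm; first exact: enum_uniq.
  by rewrite /= inE !mem_filter negb_or ij !eqxx/= andbF/= filter_uniq// enum_uniq.
move=> k; rewrite !inE mem_filter mem_enum /= andbT.
by case: eqVneq => //= _; case: eqVneq.
Qed.

(** A knot is dropped by zeroing its entry rather than by deleting the index, so that the dimension
    and the denominator [simplex_volume] stay the same throughout the recursion. *)
Definition kill a i : 'I_n -> R := fun k => if k == i then 0 else a k.

Lemma tail_kill a i j : 0 < a i -> a j < 0 ->
  (a i - a j) * tail a = a i * tail (kill a j) - a j * tail (kill a i).
Proof.
move=> ai aj; have ij : i != j by apply: contraTneq ai => ->; rewrite -leNgt ltW.
have ji : j != i by rewrite eq_sym.
set s := [seq a k | k <- enum 'I_n & (k != i) && (k != j)].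
have sE l : l \in [:: i; j] ->
    [seq kill a l k | k <- enum 'I_n & (k != i) && (k != j)] = s.
  move=> lij; apply/eq_in_map => k; rewrite mem_filter /kill => /andP[/andP[ki kj] _].
  by move: lij; rewrite !inE => /orP[] /eqP ->; rewrite (negbTE ki, negbTE kj).
have : (tail_volume a = (a i / (a i - a j))%:E * tail_volume (kill a j) +
    (- a j / (a i - a j))%:E * tail_volume (kill a i))%E.
  rewrite !(tail_volume_front _ ij) !sE ?inE ?eqxx ?orbT//.
  rewrite /kill !eqxx (negbTE ij) (negbTE ji) /= -[a j]opprK.
  rewrite dirint_opposite// ?oppr_gt0 ?opprK//.
    exact/dirints_ge0/pos_in_unit_ge0.
  by apply: measurable_dirints; [exact: pos_in_unit_ge0|exact: measurable_pos_in_unit].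
rewrite -(fineK (tail_volume_fin (kill a j))) -(fineK (tail_volume_fin (kill a i))).
rewrite -!EFinM -EFinD /tail => -> /=.
have d0 : a i - a j != 0 by rewrite gt_eqF// subr_gt0 (lt_trans aj).
have v0 : fine simplex_volume != 0.
  by rewrite gt_eqF// simplex_volume_gt0// (leq_trans _ (ltn_ord i)).
by field; rewrite d0 v0.
Qed.

End tail_fraction.

(** * Divided differences *)

Section subset_tail.
Context {R : realType} {n : nat}.
Implicit Types (a b l : 'I_n -> R) (S : {set 'I_n}) (i j k : 'I_n).

(** The recursion descends through subsets of the knots while the type of [a] is fixed, which
    permits induction on [#|S|]. *)
Definition subtail S a : R := tail (fun k => if k \in S then a k else 0).

Lemma subtail_pos S a i : i \in S -> {in S, forall k, 0 < a k} -> subtail S a = 1.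
Proof.
move=> iS S0; apply: tail_all_pos => [k|]; last by exists i; rewrite iS S0.
by case: ifP => // /S0/ltW.
Qed.

Lemma subtail_neg S a : {in S, forall k, a k < 0} -> subtail S a = 0.
Proof. by move=> S0; apply: tail_all_neg => k; case: ifP => // /S0/ltW. Qed.

Lemma kill_subset S a j :
  kill (fun k => if k \in S then a k else 0) j =
  (fun k => if k \in S :\ j then a k else 0).
Proof. by apply/funext => k; rewrite /kill !inE; case: eqVneq. Qed.

Lemma subtail_opposite S a i j : i \in S -> j \in S -> 0 < a i -> a j < 0 ->
  (a i - a j) * subtail S a = a i * subtail (S :\ j) a - a j * subtail (S :\ i) a.
Proof.
move=> iS jS ai aj; have := @tail_kill R n (fun k => if k \in S then a k else 0) i j.
by rewrite !kill_subset iS jS => /(_ ai aj).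
Qed.

(** The tail is 0, is 1, or obeys the recursion. The empty set belongs to the first case, hence the
    witness in [Sign_pos]. *)
Variant sign_spec S a : Prop :=
| Sign_neg of {in S, forall k, a k < 0}
| Sign_pos i of i \in S & {in S, forall k, 0 < a k}
| Sign_mixed i j of i \in S & j \in S & 0 < a i & a j < 0.

Lemma signP S a : {in S, forall k, a k != 0} -> sign_spec S a.
Proof.
move=> a0; have [/existsP[i /andP[iS ai]]|/existsPn noi] :=
  boolP [exists i, (i \in S) && (0 < a i)].
  have [/existsP[j /andP[jS aj]]|/existsPn noj] :=
    boolP [exists j, (j \in S) && (a j < 0)]; first exact: (Sign_mixed iS jS).
  apply: (Sign_pos iS) => k kS; have := noj k.
  by rewrite kS /= -leNgt le_eqVlt eq_sym (negbTE (a0 _ kS)).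
apply: Sign_neg => k kS; have := noi k.
by rewrite kS /= -leNgt le_eqVlt (negbTE (a0 _ kS)).
Qed.

Lemma in_setD1_sub S i (P : 'I_n -> Prop) : {in S, forall k, P k} -> {in S :\ i, forall k, P k}.
Proof. by move=> SP k; rewrite inE => /andP[_ /SP]. Qed.

(* The quotient [(subtail S a - subtail (S :\ j) a) / a j] does not depend on [j];
   for distinct entries it is the divided difference of the truncated power of
   degree [#|S| - 2]. *)
Lemma subtail_exchange S a i j : {in S, forall k, a k != 0} ->
  i \in S -> j \in S ->
  a i * (subtail S a - subtail (S :\ j) a) = a j * (subtail S a - subtail (S :\ i) a).
Proof.
move=> a0 iS jS; have [->//|ij] := eqVneq i j.
have opp p q : p \in S -> q \in S -> 0 < a p -> a q < 0 ->
    a p * (subtail S a - subtail (S :\ q) a) = a q * (subtail S a - subtail (S :\ p) a).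
  by move=> pS qS ap aq; have := subtail_opposite pS qS ap aq; lra.
have [neg|p pS pos|p q pS qS ap aq] := signP a0.
- by rewrite !subtail_neg ?subrr ?mulr0//; exact: in_setD1_sub.
- rewrite (@subtail_pos S a i)// (@subtail_pos (S :\ i) a j)// ?inE 1?eq_sym ?ij//; last first.
    exact: in_setD1_sub.
  rewrite (@subtail_pos (S :\ j) a i)// ?inE ?ij// ?subrr ?mulr0//.
  exact: in_setD1_sub.
(* Two entries of the same sign are compared through [p] or [q], whichever has the opposite sign. *)
have [ai|ai|/esym/eqP] := ltgtP (a i) 0; last by rewrite eq_sym (negbTE (a0 _ iS)).
- have [aj|aj|/esym/eqP] := ltgtP (a j) 0; last by rewrite eq_sym (negbTE (a0 _ jS)).
  + apply: (mulfI (lt0r_neq0 ap)).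
    by rewrite mulrCA (opp p j)// [RHS]mulrCA (opp p i)// mulrCA.
  + by rewrite (opp j i).
- have [aj|aj|/esym/eqP] := ltgtP (a j) 0; last by rewrite eq_sym (negbTE (a0 _ jS)).
  + by rewrite (opp i j).
  + apply: (mulfI (ltr0_neq0 aq)).
    by rewrite mulrCA -(opp j q)// [RHS]mulrCA -(opp i q)// mulrCA.
Qed.

Lemma near_same_sign (X : Type) (F : set_system X) {FF : Filter F}
    (a : X -> 'I_n -> R) b S :
  (forall i, a x i @[x --> F] --> b i) -> {in S, forall k, b k != 0} ->
  \forall x \near F, {in S, forall k, (0 < a x k) = (0 < b k) /\ (a x k < 0) = (b k < 0)}.
Proof.
move=> ab b0.
have : \forall x \near F, forall k, k \in S -> (0 < a x k) = (0 < b k) /\ (a x k < 0) = (b k < 0).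
  apply: filter_forall => k; have [kS|kS] := boolP (k \in S); last exact: nearW.
  have [bk|bk|/eqP] := ltgtP (b k) 0; last by rewrite (negbTE (b0 _ kS)).
    apply: filterS (cvgr_lt _ (ab k) _ bk) => x akx _.
    by rewrite akx ltNge (ltW akx).
  apply: filterS (cvgr_gt _ (ab k) _ bk) => x akx _.
  by rewrite akx ltNge (ltW akx).
by apply: filterS => x + k; exact.
Qed.

Lemma cvg_subtail (X : Type) (F : set_system X) {FF : Filter F}
    (a : X -> 'I_n -> R) b S :
  (forall i, a x i @[x --> F] --> b i) -> {in S, forall k, b k != 0} ->
  subtail S (a x) @[x --> F] --> subtail S b.
Proof.
move=> ab; have [m] := ubnP #|S|; elim: m S => // m IH S Sm b0.
have sgn := @near_same_sign X F FF a b S ab b0.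
have [neg|i iS pos|i j iS jS bi bj] := signP b0.
- rewrite (subtail_neg neg); apply: cvg_near_cst; apply: filterS sgn => x sx.
  by apply: subtail_neg => k kS; rewrite (sx k kS).2 neg.
- rewrite (subtail_pos iS pos); apply: cvg_near_cst; apply: filterS sgn => x sx.
  by apply: (subtail_pos iS) => k kS; rewrite (sx k kS).1 pos.
(* [subtail_opposite] solved for the tail of [S]. The tails in [f] are those of smaller sets, to
   which the induction applies, and [f] agrees with [subtail S] wherever [a i > 0 > a j], hence near
   [b]. *)
pose f a := (a i * subtail (S :\ j) a - a j * subtail (S :\ i) a) / (a i - a j).
have fE a' : 0 < a' i -> a' j < 0 -> f a' = subtail S a'.
  move=> ai aj; rewrite /f -subtail_opposite// mulrC mulKf//.
  by rewrite gt_eqF// subr_gt0 (lt_trans aj).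
rewrite -fE//.
have H : f (a x) @[x --> F] --> f b.
  have SD k : k \in S -> (#|S :\ k| < m)%N by move=> kS; rewrite (cardsD1 k S) kS in Sm.
  apply: cvgM; last first.
    apply: cvgV; last exact: cvgB.
    by rewrite gt_eqF// subr_gt0 (lt_trans bj).
  by apply: cvgB; apply: cvgM => //; apply: IH; rewrite ?SD//; exact: in_setD1_sub.
apply: cvg_trans H; apply: near_eq_cvg; apply: filterS sgn => x sx /=.
by rewrite fE// ?(sx i iS).1 ?(sx j jS).2.
Qed.

(** If the signs are mixed, [subtail_opposite] expresses the tail by tails of two smaller sets with
    coefficients affine in [y]. Differentiating these coefficients adds 1 to the factor [#|S|.-2]
    coming from the induction. By [subtail_exchange] the quotient may be taken at any [i]. *)
Lemma is_derive_subtail S l (x : R) i : {in S, forall k, l k - x != 0} -> i \in S ->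
  is_derive x 1 (fun y => subtail S (fun k => l k - y))
    (- (#|S|.-1)%:R * ((subtail S (fun k => l k - x) -
       subtail (S :\ i) (fun k => l k - x)) / (l i - x))).
Proof.
have [m] := ubnP #|S|; elim: m S i => // m IH S i Sm a0 iS.
have al k : l k - y @[y --> x] --> l k - x by apply: cvgB => //; exact: cvg_cst.
have sgn := @near_same_sign R (nbhs x) (nbhs_filter x) _ _ S al a0.
have cst_case : (\forall y \near x, subtail S (fun k => l k - y) = subtail S (fun k => l k - x)) ->
  (#|S|.-1)%:R * (subtail S (fun k => l k - x) - subtail (S :\ i) (fun k => l k - x)) = 0 ->
  is_derive x 1 (fun y => subtail S (fun k => l k - y))
    (- (#|S|.-1)%:R * ((subtail S (fun k => l k - x) -
       subtail (S :\ i) (fun k => l k - x)) / (l i - x))).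
  move=> cS S0; rewrite mulNr mulrA S0 mul0r oppr0.
  apply: (near_eq_is_derive (f := cst (subtail S (fun k => l k - x)))) => //.
  by apply: filterS cS => y ->.
have [neg|p pS pos|p q pS qS bp bq] := signP a0.
- apply: cst_case.
    apply: filterS sgn => y sy; rewrite !subtail_neg// => k kS.
    by rewrite (sy k kS).2 neg.
  by rewrite !subtail_neg ?subrr ?mulr0//; exact: in_setD1_sub.
- apply: cst_case.
    apply: filterS sgn => y sy; rewrite !(subtail_pos iS)// => k kS.
    by rewrite (sy k kS).1 pos.
  (* For a singleton the two tails are 1 and 0, but then the factor [#|S|.-1] vanishes. *)
  rewrite (subtail_pos iS pos); have [/eqP S0|[j jS]] := set_0Vmem (S :\ i).
    by rewrite (cardsD1 i S) iS (eqP S0) cards0 mul0r.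
  by rewrite (subtail_pos jS) ?subrr ?mulr0//; exact: in_setD1_sub.
set a := fun k => l k - x in a0 bp bq sgn *.
have pq : p != q by apply: contraTneq bp => ->; rewrite -leNgt ltW.
have qp : q != p by rewrite eq_sym.
have d0 : l p - l q != 0.
  by have := lt_trans bq bp; rewrite /a ltrD2r => lqp; rewrite subr_eq0 gt_eqF.
have qSp : q \in S :\ p by rewrite !inE qp.
have pSq : p \in S :\ q by rewrite !inE pq.
have SDm k : k \in S -> (#|S :\ k| < m)%N by move=> kS; rewrite (cardsD1 k S) kS in Sm.
(* The quotient is taken at [p] for [S :\ q] and at [q] for [S :\ p]: both then involve the tail of
   [S] without [p] and [q], which cancels in the product rule. *)
have IHq := IH _ _ (SDm _ qS) (in_setD1_sub a0) pSq.
have IHp := IH _ _ (SDm _ pS) (in_setD1_sub a0) qSp.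
have E : S :\ q :\ p = S :\ p :\ q by apply/setP => k; rewrite !inE andbCA.
have cE k : k \in S -> #|S :\ k| = #|S|.-1 by move=> kS; rewrite (cardsD1 k S) kS.
rewrite !cE// -/a E in IHp IHq.
have c1 : (0 < #|S|.-1)%N by rewrite -(cE p)//; apply/card_gt0P; exists q.
have c2 : (#|S|.-1)%:R = #|S|.-1.-1%:R + 1 :> R by rewrite natr1 prednK.
pose U y := subtail (S :\ q) (fun k => l k - y).
pose W y := subtail (S :\ p) (fun k => l k - y).
pose H : R -> R := (l p - l q)^-1 \*: ((cst (l p) - id) * U - (cst (l q) - id) * W).
apply: (near_eq_is_derive (f := H)).
  apply: filterS sgn => y sy; rewrite /H /= /GRing.scale /=.
  rewrite -[(_ - _) y]/((l p - y) * U y - (l q - y) * W y).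
  rewrite -(@subtail_opposite S (fun k => l k - y)) ?(sy p pS).1 ?(sy q qS).2//.
  by rewrite opprB addrA subrK mulKf.
apply: is_derive_eq.
have -> : (subtail S a - subtail (S :\ i) a) / (l i - x) =
    (subtail S a - W x) / (l p - x).
  apply/eqP; rewrite eqr_div ?a0//; apply/eqP.
  by rewrite mulrC -[RHS]mulrC -[RHS]subtail_exchange.
have := @subtail_opposite S a p q pS qS bp bq.
have dE : l p - l q = a p - a q by rewrite /a opprB addrA subrK.
move: d0; rewrite -/(U x) -/(W x) c2 /GRing.scale /= dE.
rewrite -[(cst (l p) - id) x]/(a p) -[(cst (l q) - id) x]/(a q).
rewrite -[l p - x]/(a p) -[l q - x]/(a q).
have A0 : a p != 0 := lt0r_neq0 bp.
have B0 : a q != 0 := ltr0_neq0 bq.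
move: (a p) (a q) A0 B0 => A B A0 B0; move: (subtail S a) => G.
move: (U x) => u; move: (W x) => w; move: (subtail _ a) => Z.
move: #|S|.-2 => c d0 opp; have -> : G = (A * u - B * w) / (A - B).
  by rewrite -opp mulrC mulKf.
by field; rewrite A0 d0.
Qed.

(** The divided difference over the nodes in [S] of a function given by its values [w]; indexing the
    values lets a factor [a k] be absorbed into [w]. *)
Definition divsum (w a : 'I_n -> R) S : R :=
  \sum_(k in S) w k / \prod_(l in S :\ k) (a k - a l).

(** The Leibniz rule for a product with the identity function: write [a k = a j + (a k - a j)],
    where the second term cancels one factor of the denominator. *)
Lemma divsumM w a S j : injective a -> j \in S ->
  divsum (fun k => a k * w k) a S = a j * divsum w a S + divsum w a (S :\ j).
Proof.
move=> ia jS; apply/eqP; rewrite addrC -subr_eq /divsum mulr_sumr -sumrB.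
rewrite (big_setD1 j)//= mulrA subrr add0r; apply/eqP; apply: eq_bigr => k.
rewrite !inE => /andP[kj kS].
have jSk : j \in S :\ k by rewrite !inE eq_sym kj.
rewrite (big_setD1 j jSk) /=.
have -> : S :\ k :\ j = S :\ j :\ k by apply/setP => m; rewrite !inE andbCA.
have kj0 : a k - a j != 0 by rewrite subr_eq0 (inj_eq ia).
by rewrite invfM; move: (\prod_(_ in _) _)^-1 => v; field.
Qed.

(** The classical recursion of divided differences, by comparing the Leibniz rule at [i] and at
    [j]. *)
Lemma divsum_diff w a S i j : injective a -> i \in S -> j \in S ->
  (a i - a j) * divsum w a S = divsum w a (S :\ j) - divsum w a (S :\ i).
Proof.
by move=> ia iS jS; have := divsumM w ia iS; rewrite (divsumM w ia jS); lra.
Qed.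

Definition pospow (m : nat) (y : R) : R := if 0 < y then y ^+ m else 0.

(** Both sides satisfy the recursion of [subtail_opposite]: on the right it follows from the Leibniz
    rule, because a truncated power is [y] times the one of the previous degree. On a singleton both
    are the indicator of a positive entry. *)
Lemma subtail_divsum S a : injective a -> {in S, forall k, a k != 0} -> S != finset.set0 ->
  subtail S a = divsum (fun k => pospow #|S|.-1 (a k)) a S.
Proof.
have [m] := ubnP #|S|; elim: m S => // m IH S Sm ia a0 /finset.set0Pn[s sS].
have SDm k : k \in S -> (#|S :\ k| < m)%N by move=> kS; rewrite (cardsD1 k S) kS in Sm.
have cE k : k \in S -> #|S :\ k| = #|S|.-1 by move=> kS; rewrite (cardsD1 k S) kS.
have [/eqP S0|/finset.set0Pn[t tS]] := boolP (S :\ s == finset.set0).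
  have SE : S = [set s]%SET by rewrite -(finset.setD1K sS) S0 finset.setU0.
  rewrite SE /divsum big_set1 cards1 /= /pospow expr0.
  have -> : [set s]%SET :\ s = finset.set0 by apply/setP => k; rewrite !inE andNb.
  rewrite big_set0 divr1.
  case: ifPn => as0; first by apply: (@subtail_pos _ _ s); rewrite ?inE// => k /set1P ->.
  apply: subtail_neg => k /set1P ->; move: as0; rewrite -leNgt le_eqVlt.
  by rewrite (negbTE (a0 _ sS)).
(* If all signs agree, the three tails are all 0 or all 1, and the recursion holds for any two
   elements. *)
have {t tS}[i [j [iS jS ij EG]]] : exists i j, [/\ i \in S, j \in S, i != j &
    (a i - a j) * subtail S a = a i * subtail (S :\ j) a - a j * subtail (S :\ i) a].
  move: tS; rewrite !inE => /andP[ts tS].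
  have [neg|p pS pos|p q pS qS bp bq] := signP a0.
  - exists s, t; rewrite eq_sym ts; split => //.
    by rewrite !subtail_neg ?mulr0 ?subrr//; exact: in_setD1_sub.
  - exists s, t; rewrite eq_sym ts; split => //.
    have sSt : s \in S :\ t by rewrite !inE eq_sym ts.
    have tSs : t \in S :\ s by rewrite !inE ts.
    by rewrite (subtail_pos sS pos) (subtail_pos sSt (in_setD1_sub pos))
      (subtail_pos tSs (in_setD1_sub pos)) !mulr1.
  - exists p, q; split => //; last exact: subtail_opposite.
    by apply: contraTneq bp => ->; rewrite -leNgt ltW.
have nz k (l : 'I_n) : l \in S -> k != l -> S :\ k != finset.set0.
  by move=> lS kl; apply/finset.set0Pn; exists l; rewrite !inE eq_sym kl.
have d0 : a i - a j != 0 by rewrite subr_eq0 (inj_eq ia).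
apply: (mulfI d0); rewrite EG.
rewrite !IH ?SDm//; try exact: in_setD1_sub; last 2 first.
- by apply: (nz _ j).
- by apply: (nz _ i); rewrite 1?eq_sym.
rewrite !cE//.
have [c Ec] : exists c, #|S| = c.+2.
  have : (0 < #|S :\ i|)%N by rewrite card_gt0 (nz _ j).
  by rewrite cE//; case: #|S| => [|[|c]]// _; exists c.
rewrite Ec /=.
have powS k : pospow c.+1 (a k) = a k * pospow c (a k).
  by rewrite /pospow; case: ifP; rewrite ?mulr0// exprS.
set w := fun k => pospow c (a k).
have wE T : divsum (fun k => pospow c.+1 (a k)) a T = divsum (fun k => a k * w k) a T.
  by apply: eq_bigr => k _; rewrite powS.
rewrite wE (divsumM w ia jS) mulrDr mulrCA (divsum_diff w ia iS jS).
by ring.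
Qed.

(** One step of the recursion passes from all [n] nodes to [n - 1] of them, for which [n - 2] is
    exactly the exponent in [subtail_divsum]. *)
Lemma divsum_subtail a i j : injective a -> (forall k, a k != 0) -> i != j ->
  (a i - a j) * divsum (fun k => pospow n.-2 (a k)) a finset.setT =
  subtail (finset.setT :\ j) a - subtail (finset.setT :\ i) a.
Proof.
move=> ia a0 ij; rewrite divsum_diff ?inE//.
have c k : #|finset.setT :\ k|.-1 = n.-2.
  by rewrite -[in RHS](card_ord n) -finset.cardsT (cardsD1 k finset.setT) inE.
have ne (k l : 'I_n) : k != l -> finset.setT :\ k != finset.set0.
  by move=> kl; apply/finset.set0Pn; exists l; rewrite !inE eq_sym kl.
rewrite (subtail_divsum ia (fun k _ => a0 k) (ne j i _)) 1?eq_sym//.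
by rewrite (subtail_divsum ia (fun k _ => a0 k) (ne i j ij)) !c.
Qed.

End subset_tail.

(** * The squared modulus on the plane *)

Section squared_modulus.
Context {R : realType}.
Local Notation mu := (@lebesgue_measure R).
Local Notation T := (measurableTypeR R).
Local Open Scope ereal_scope.

Definition sqmod (z : plane R) : T := (z.1 ^+ 2 + z.2 ^+ 2)%R.

Lemma measurable_sqmod : measurable_fun setT sqmod.
Proof. by apply: measurable_funD; apply: measurable_funX; measfun. Qed.

Lemma sqmod_ge0 z : (0 <= sqmod z)%R.
Proof. by rewrite addr_ge0// sqr_ge0. Qed.

Lemma integral_plane (f : plane R -> \bar R) : measurable_fun setT f ->
  (forall z, 0 <= f z) ->
  \int[lebesgue_plane R]_z f z = \int[mu]_x \int[mu]_y f (x, y).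
Proof. by move=> mf f0; exact: (@fubini_tonelli1 _ _ _ _ _ mu mu f mf f0). Qed.

Definition open_disk (b : R) : set (plane R) := [set z | (sqmod z < b)%R].

Lemma measurable_open_disk b : measurable (open_disk b).
Proof.
rewrite (_ : open_disk b = sqmod @^-1` `]-oo, b[%classic).
  by rewrite -[X in measurable X]setTI; exact: measurable_sqmod.
by apply/seteqP; split => z /=; rewrite in_itv.
Qed.

Lemma disk_ind_measurable b :
  measurable_fun setT (fun z : plane R => if (sqmod z < b)%R then 1 else 0 : \bar R).
Proof.
apply: measurable_fun_ifT => //.
by apply: measurable_fun_ltr => //; exact: measurable_sqmod.
Qed.

Lemma open_diskE b :
  lebesgue_plane R (open_disk b) = \int[mu]_x \int[mu]_y (if (sqmod (x, y) < b)%R then 1 else 0).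
Proof.
transitivity (\int[lebesgue_plane R]_z (if (sqmod z < b)%R then 1 else 0)); last first.
  by apply: integral_plane; [exact: disk_ind_measurable|move=> z; case: ifP].
rewrite -[LHS]mul1e -(integral_cst _ (measurable_open_disk b)).
rewrite integral_mkcond; apply: eq_integral => z _; rewrite patchE.
by congr (if _ then _ else _); apply/idP/idP; rewrite inE.
Qed.

(** Area is linear in the squared radius [b], as each of the two real coordinates scales by
    [Num.sqrt b]. This linearity makes the image of area under [sqmod] proportional to length. *)
Lemma open_disk_scale (b : R) : (0 < b)%R ->
  lebesgue_plane R (open_disk b) = b%:E * lebesgue_plane R (open_disk 1).
Proof.
move=> b0; have s0 : (0 < Num.sqrt b)%R by rewrite sqrtr_gt0.
pose g (z : T * T) : \bar R := if (sqmod z < b)%R then 1 else 0.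
have g0 z : 0 <= g z by rewrite /g; case: ifP.
have mg : measurable_fun setT g by exact: disk_ind_measurable.
have mgx (x : T) : measurable_fun setT (fun y : T => g (x, y)).
  by apply: (measurableT_comp mg); measfun.
have mF : measurable_fun setT (fun x : T => \int[mu]_y g (x, y)).
  exact: (@measurable_fun_fubini_tonelli_F _ _ _ _ _ mu g).
rewrite !open_diskE -/(g _).
have -> : \int[mu]_x \int[mu]_y (if (sqmod (x, y) < 1)%R then 1 else 0) =
    \int[mu]_x \int[mu]_y g (Num.sqrt b * x, Num.sqrt b * y)%R.
  apply: eq_integral => x _; apply: eq_integral => y _; rewrite /g /sqmod /=.
  by rewrite !exprMn sqr_sqrtr ?ltW// -mulrDr gtr_pMr.
have inner x : \int[mu]_y g (Num.sqrt b * x, Num.sqrt b * y)%R =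
    (Num.sqrt b)^-1%:E * \int[mu]_y g (Num.sqrt b * x, y)%R.
  by apply: (lebesgue_integral_scale s0 (mgx _)) => y; exact: g0.
have -> : \int[mu]_x \int[mu]_y g (Num.sqrt b * x, Num.sqrt b * y)%R =
    \int[mu]_x ((Num.sqrt b)^-1%:E * \int[mu]_y g (Num.sqrt b * x, y)%R).
  by apply: eq_integral => x _; exact: inner.
rewrite ge0_integralZl//; last 2 first.
- have ms : measurable_fun setT (fun x : T => Num.sqrt b * x : T)%R by measfun.
  exact: (measurableT_comp mF ms).
- by move=> x _; exact: integral_ge0.
have -> : \int[mu]_x \int[mu]_y g (Num.sqrt b * x, y)%R =
    (Num.sqrt b)^-1%:E * \int[mu]_x \int[mu]_y g (x, y).
  by apply: (lebesgue_integral_scale s0 mF) => x; exact: integral_ge0.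
rewrite !muleA -!EFinM.
have -> : (b * (Num.sqrt b)^-1 * (Num.sqrt b)^-1 = 1)%R.
  by rewrite -mulrA -invfM -expr2 sqr_sqrtr ?ltW// divff// gt_eqF.
by rewrite mul1e.
Qed.

(** The disk lies between the squares of sides 1 and 2. *)
Lemma open_disk1_bounds : 0 < lebesgue_plane R (open_disk 1) < +oo.
Proof.
have mI (a b : R) : measurable (`[a, b]%classic : set T) by [].
have sq (a b : R) : lebesgue_plane R (`[a, b] `*` `[a, b]) =
    mu `[a, b]%classic * mu `[a, b]%classic.
  by rewrite -product_measure1E.
apply/andP; split.
  apply: (@lt_le_trans _ _ (lebesgue_plane R (`[(- 2^-1)%R, 2^-1%R] `*` `[(- 2^-1)%R, 2^-1%R]))).
    rewrite sq lebesgue_measure_itv /= lte_fin.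
    by rewrite gtrN ?invr_gt0// -EFinB opprK -EFinM lte_fin mulr_gt0// addr_gt0// invr_gt0.
  apply: le_measure; rewrite ?inE//; [exact: measurableX|exact: measurable_open_disk|].
  move=> [x y] [/=]; rewrite !in_itv /= /open_disk /sqmod /= => /andP[x1 x2] /andP[y1 y2].
  by nra.
apply: (@le_lt_trans _ _ (lebesgue_plane R (`[(- 1)%R, 1%R] `*` `[(- 1)%R, 1%R]))).
  apply: le_measure; rewrite ?inE//; [exact: measurable_open_disk|exact: measurableX|].
  move=> [x y]; rewrite /open_disk /sqmod /= => xy; split => /=; rewrite in_itv /=; nra.
by rewrite sq lebesgue_measure_itv /= lte_fin gtrN// -EFinB -EFinM ltry.
Qed.

Definition disk_area : R := fine (lebesgue_plane R (open_disk 1)).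

Lemma disk_area_gt0 : (0 < disk_area)%R.
Proof. by rewrite fine_gt0// open_disk1_bounds. Qed.

Lemma disk_areaE : lebesgue_plane R (open_disk 1) = disk_area%:E.
Proof.
have /andP[c0 coo] := open_disk1_bounds.
by rewrite fineK// ge0_fin_numE// ltW.
Qed.

(** The half-lines []-oo, b[] are stable under intersection and generate the Borel sets. Their
    preimages under [sqmod] are disks, empty for [b <= 0], so the image measure is [disk_area] times
    Lebesgue measure restricted to the nonnegative half-line. *)
Lemma integral_sqmod (f : T -> \bar R) : measurable_fun setT f -> (forall t, 0 <= f t) ->
  \int[lebesgue_plane R]_z f (sqmod z) =
  disk_area%:E * \int[mu]_t (if (0 <= t)%R then f t else 0).
Proof.
move=> mf f0.
have mD : measurable (`[0%R, +oo[%classic : set T) by [].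
pose c : {nonneg R} := NngNum (ltW disk_area_gt0).
have msq := measurable_sqmod.
have E A : measurable A -> pushforward (lebesgue_plane R) sqmod A = mscale c (mrestr mu mD) A.
  have U := @measure_unique _ R T (@RGenInftyO.G R) (fun k => `]-oo, k%:R[%classic : set T) _ _ _ _
    (pushforward (lebesgue_plane R) sqmod) (mscale c (mrestr mu mD)).
  move=> mA; apply: (U _ _ _ _ msq) mA.
  - exact: RGenInftyO.measurableE.
  - move=> _ _ [x ->] [y ->]; exists (Num.min x y).
    by apply/seteqP; split => t /=; rewrite !in_itv /= lt_min => /andP.
  - by move=> k; exists k%:R.
  - apply/seteqP; split => // t _; exists (Num.truncn `|t|).+1 => //=.
    by rewrite in_itv /= (le_lt_trans (ler_norm _))// truncnS_gt.
  - move=> _ [b ->]; rewrite /mscale /= /mrestr /pushforward.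
    rewrite [X in lebesgue_plane R X](_ : _ = open_disk b); last first.
      by apply/seteqP; split => z /=; rewrite in_itv.
    have [b0|b0] := ltP 0%R b.
      rewrite open_disk_scale// disk_areaE muleC; congr (_ * _).
      transitivity (mu `[0%R, b[%classic).
        by rewrite lebesgue_measure_itv /= lte_fin b0 -EFinB subr0.
      congr (mu _); apply/seteqP; split => t /=; rewrite !in_itv /= ?andbT.
        by move=> /andP[-> ->].
      by move=> [-> ->].
    rewrite [X in lebesgue_plane R X](_ : _ = set0); last first.
      rewrite -subset0 => z; rewrite /open_disk /= => zb.
      by have := sqmod_ge0 z; rewrite leNgt (lt_le_trans zb).
    rewrite measure0; transitivity (c%:num%:E * mu set0); first by rewrite measure0 mule0.
    congr (_ * mu _); apply/esym; rewrite -subset0 => t /=.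
    rewrite !in_itv /= andbT => -[tb]; rewrite leNgt.
    by rewrite (lt_le_trans tb).
  - move=> k; rewrite /pushforward.
    apply: (@le_lt_trans _ _ (lebesgue_plane R (open_disk k.+1%:R))).
      apply: (@le_measure _ _ _ (lebesgue_plane R)); rewrite ?inE; [|exact: measurable_open_disk|].
        by rewrite -[X in measurable X]setTI; exact: msq.
      move=> z; rewrite /open_disk /= in_itv /= => /lt_trans; apply.
      by rewrite ltr_nat.
    by rewrite open_disk_scale// disk_areaE -EFinM ltry.
transitivity (\int[pushforward (lebesgue_plane R) sqmod]_t f t).
  by rewrite ge0_integral_pushforward.
rewrite (eq_measure_integral (mscale c (mrestr mu mD))); last by move=> A mA _; exact: E.
rewrite ge0_integral_mscale//; congr (_ * _).
rewrite (@ge0_negligible_integral _ _ _ _ setT (~` (`[0%R, +oo[%classic : set T)))//; last 2 first.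
- exact: measurableC.
- by rewrite /= /mrestr /= setICl measure0.
rewrite setTD setCK (eq_measure_integral mu); last first.
  by move=> A mA AD; rewrite /= /mrestr; congr (mu _); exact/setIidl/AD.
rewrite integral_mkcond; apply: eq_integral => t _; rewrite patchE.
by congr (if _ then _ else _); apply/idP/idP; rewrite inE /= in_itv /= andbT.
Qed.

End squared_modulus.

(** * Lebesgue measure on C^n *)

Section complex_space_integrals.
Context {R : realType}.
Local Notation mu := (@lebesgue_measure R).
Local Notation T := (measurableTypeR R).
Local Open Scope ereal_scope.

Lemma integral_CnS n (f : Cn R n.+1 -> \bar R) : measurable_fun setT f ->
  (forall x, 0 <= f x) ->
  \int[lebesgue_Cn R n.+1]_x f x =
  \int[lebesgue_plane R]_z \int[lebesgue_Cn R n]_x f [tuple of z :: x].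
Proof.
move=> mf f0.
have mt := @measurable_tuple_of_pair _ (plane R) n.
transitivity (\int[pushforward (prod_measure (lebesgue_plane R) (lebesgue_Cn R n))
    (@tuple_of_pair _ (plane R) n)]_x f x).
  by apply: eq_measure_integral => A mA _.
rewrite ge0_integral_pushforward//.
exact: (@fubini_tonelli1 _ _ _ _ _ (lebesgue_plane R) (lebesgue_Cn R n)
  (f \o @tuple_of_pair _ (plane R) n) (measurableT_comp mf mt) (fun z => f0 _)).
Qed.

Lemma integral_Cn0 (f : Cn R 0 -> \bar R) : (forall x, 0 <= f x) ->
  measurable_fun setT f -> \int[lebesgue_Cn R 0]_x f x = f [tuple].
Proof.
move=> f0 mf; transitivity (\int[dirac ([tuple] : Cn R 0)]_x f x).
  by apply: eq_measure_integral => A mA _.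
by rewrite integral_dirac// diracT mul1e.
Qed.

Lemma measurable_fun_cons n (f : Cn R n.+1 -> \bar R) (z : plane R) :
  measurable_fun setT f -> measurable_fun setT (fun x : Cn R n => f [tuple of z :: x]).
Proof.
move=> mf; apply: (measurableT_comp mf).
by apply: measurable_cons => //; exact: measurable_id.
Qed.

Lemma measurable_fun_consl n (f : Cn R n.+1 -> \bar R) :
  measurable_fun setT f -> (forall x, 0 <= f x) ->
  measurable_fun setT (fun z : plane R => \int[lebesgue_Cn R n]_x f [tuple of z :: x]).
Proof.
move=> mf f0.
have mt := @measurable_tuple_of_pair _ (plane R) n.
exact: (@measurable_fun_fubini_tonelli_F _ _ _ _ _ (lebesgue_Cn R n)
  (f \o @tuple_of_pair _ (plane R) n) (measurableT_comp mf mt) (fun z => f0 _)).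
Qed.

(** The value at [x] of a diagonal Hermitian form and the squared norm of [x]. The offset [w]
    absorbs the coordinates already split off. *)
Definition form_pair n (s : n.-tuple R) (w : T * T) (x : Cn R n) : T * T :=
  ((w.1 + \sum_(i < n) tnth s i * sqmod (tnth x i))%R,
   (w.2 + \sum_(i < n) sqmod (tnth x i))%R).

Lemma measurable_form_pair n (s : n.-tuple R) w : measurable_fun setT (form_pair s w).
Proof.
have msq i : measurable_fun setT (fun x : Cn R n => sqmod (tnth x i)).
  by apply: (measurableT_comp measurable_sqmod); exact: measurable_tnth.
apply: measurable_fun_pair; apply: measurable_funD => //;
  apply: measurable_sum => i; last exact: msq.
by apply: measurable_funM; [exact: measurable_cst|exact: msq].
Qed.

(** [lebesgue_Cn] splits off a complex coordinate as [dirints] splits off a direction. The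
    coordinate enters through its squared modulus only and contributes one factor [disk_area]. *)
Lemma integral_form_pair n (s : n.-tuple R) (h : T * T -> \bar R) w :
  (forall w, 0 <= h w) -> measurable_fun setT h ->
  \int[lebesgue_Cn R n]_x h (form_pair s w x) = ((@disk_area R) ^+ n)%:E * dirints s h w.
Proof.
move=> h0 mh; elim: n s w => [|n IH] s w.
  rewrite integral_Cn0//; last first.
    by apply: (measurableT_comp mh); exact: measurable_form_pair.
  rewrite (tuple0 s) /= expr0 mul1e /form_pair !big_ord0 !addr0.
  by case: w.
case/tupleP: s => a s; rewrite integral_CnS//; last first.
  by apply: (measurableT_comp mh); exact: measurable_form_pair.
have E (z : plane R) (x : Cn R n) : form_pair [tuple of a :: s] w [tuple of z :: x] =
    form_pair s (w.1 + a * sqmod z, w.2 + sqmod z)%R x.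
  rewrite /form_pair /= !big_ord_recl !tnth0 !addrA; congr (_ + _, _ + _)%R.
    by apply: eq_bigr => i _; rewrite !tnthS.
  by apply: eq_bigr => i _; rewrite !tnthS.
pose g (t : T) := dirints s h (w.1 + a * t, w.2 + t)%R.
have g0 t : 0 <= g t by exact: dirints_ge0.
have mg : measurable_fun setT g.
  by apply: (measurableT_comp (measurable_dirints s h0 mh)); measfun.
transitivity (\int[lebesgue_plane R]_z (((@disk_area R) ^+ n)%:E * g (sqmod z))).
  by apply: eq_integral => z _; rewrite -IH; apply: eq_integral => x _; rewrite E.
rewrite ge0_integralZl//; last 2 first.
- exact: (measurableT_comp mg measurable_sqmod).
- by rewrite lee_fin exprn_ge0// ltW// disk_area_gt0.
by rewrite (integral_sqmod mg g0) muleA -EFinM -exprSr.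
Qed.

Definition addCn n (x y : Cn R n) : Cn R n :=
  [tuple ((tnth x i).1 + (tnth y i).1, (tnth x i).2 + (tnth y i).2)%R | i < n].

Lemma measurable_addCn n d (X : measurableType d) (f g : X -> Cn R n) :
  measurable_fun setT f -> measurable_fun setT g ->
  measurable_fun setT (fun x => addCn (f x) (g x)).
Proof.
move=> mf mg; apply/measurable_fun_tnthP => i.
rewrite (_ : _ \o _ = fun x => ((tnth (f x) i).1 + (tnth (g x) i).1,
    (tnth (f x) i).2 + (tnth (g x) i).2)%R); last first.
  by apply/funext => x /=; rewrite tnth_mktuple.
have mtf := measurableT_comp (measurable_tnth i) mf.
have mtg := measurableT_comp (measurable_tnth i) mg.
by measfun.
Qed.

Lemma integral_plane_shift (f : plane R -> \bar R) (w : plane R) :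
  measurable_fun setT f -> (forall z, 0 <= f z) ->
  \int[lebesgue_plane R]_z f (z.1 + w.1, z.2 + w.2)%R = \int[lebesgue_plane R]_z f z.
Proof.
move=> mf f0; rewrite integral_plane//; last by apply: (measurableT_comp mf); measfun.
rewrite [RHS]integral_plane// -[RHS](lebesgue_integral_shift w.1); last 2 first.
- exact: (@measurable_fun_fubini_tonelli_F _ _ _ _ _ mu f).
- by move=> x; exact: integral_ge0.
apply: eq_integral => x _.
apply: (lebesgue_integral_shift w.2 (f := fun y => f (x + w.1, y)%R)) => //.
by apply: (measurableT_comp mf); measfun.
Qed.

Lemma integral_Cn_shift n (f : Cn R n -> \bar R) (w : Cn R n) :
  measurable_fun setT f -> (forall x, 0 <= f x) ->
  \int[lebesgue_Cn R n]_x f (addCn x w) = \int[lebesgue_Cn R n]_x f x.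
Proof.
elim: n f w => [|n IH] f w mf f0.
  by apply: eq_integral => x _; congr (f _); rewrite (tuple0 x) (tuple0 (addCn _ _)).
have mfw : measurable_fun setT (fun x => f (addCn x w)).
  by apply: (measurableT_comp mf); apply: measurable_addCn.
rewrite integral_CnS// [RHS]integral_CnS//.
case/tupleP: w mfw => u w mfw.
rewrite -[RHS](integral_plane_shift u); last 2 first.
- exact: measurable_fun_consl.
- by move=> z; exact: integral_ge0.
apply: eq_integral => z _.
rewrite -(IH (fun x => f [tuple of (z.1 + u.1, z.2 + u.2)%R :: x]) w); last 2 first.
- exact: measurable_fun_cons.
- by [].
apply: eq_integral => x _; congr (f _); apply: eq_from_tnth => i.
rewrite tnth_mktuple; case: (unliftP ord0 i) => [j|] ->.
  by rewrite !tnthS tnth_mktuple.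
by rewrite !tnth0.
Qed.

End complex_space_integrals.

(** * Linear maps and translations of C^n *)

Section linear_maps.
Context {R : realType} {n : nat}.
Local Notation X := (Cn R n).
Local Notation m := (lebesgue_Cn R n).
Local Open Scope ereal_scope.

Definition unvec (v : 'cV[R[i]]_n) : X :=
  [tuple (complex.Re (v i ord0), complex.Im (v i ord0)) | i < n].

Lemma vecK : cancel (@vec R n) unvec.
Proof.
by move=> x; apply: eq_from_tnth => i; rewrite tnth_mktuple mxE /=; case: (tnth x i).
Qed.

Lemma unvecK : cancel unvec (@vec R n).
Proof.
move=> v; apply/matrixP => i j; rewrite mxE tnth_mktuple /= [j]ord1.
by case: (v i ord0).
Qed.

Lemma addCnE (x y : X) : addCn x y = unvec (vec x + vec y)%R.
Proof. by apply: eq_from_tnth => i; rewrite !tnth_mktuple !mxE. Qed.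

Definition linCn (U : 'M[R[i]]_n) (x : X) : X := unvec (U *m vec x)%R.

Definition oppCn (x : X) : X := unvec (- vec x)%R.

Lemma measurable_linCn U : measurable_fun setT (linCn U).
Proof.
have mre j : measurable_fun setT (fun x : X => (tnth x j).1 : measurableTypeR R).
  by apply: measurable_fun_proj1; exact: measurable_tnth.
have mim j : measurable_fun setT (fun x : X => (tnth x j).2 : measurableTypeR R).
  by apply: measurable_fun_proj2; exact: measurable_tnth.
apply/measurable_fun_tnthP => i.
rewrite (_ : _ \o _ = fun x : X =>
  ((\sum_j (complex.Re (U i j) * (tnth x j).1 -
             complex.Im (U i j) * (tnth x j).2))%R : measurableTypeR R,
   (\sum_j (complex.Re (U i j) * (tnth x j).2 +
             complex.Im (U i j) * (tnth x j).1))%R : measurableTypeR R)).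
  apply: measurable_fun_pair; apply: measurable_sum => j.
    by apply: measurable_funB; apply: measurable_funM;
      by [exact: measurable_cst|exact: mre|exact: mim].
  by apply: measurable_funD; apply: measurable_funM;
    by [exact: measurable_cst|exact: mre|exact: mim].
apply/funext => x /=; rewrite tnth_mktuple !mxE !raddf_sum /=.
by congr (_, _); apply: eq_bigr => j _; rewrite mxE; case: (U i j) (tnth x j) => a b [c d].
Qed.

Lemma measurable_oppCn : measurable_fun setT oppCn.
Proof.
rewrite (_ : oppCn = linCn (- 1%:M)%R); first exact: measurable_linCn.
by apply/funext => x; rewrite /linCn mulNmx mul1mx.
Qed.

Lemma linCn_unitK U (x y : X) : U \in unitmx ->
  linCn U (addCn x (linCn (invmx U) (oppCn y))) = addCn (linCn U x) (oppCn y).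
Proof. by move=> Uu; rewrite /linCn !addCnE !unvecK mulmxDr mulKVmx// unvecK. Qed.

Lemma addCn_opp_shift (x y : X) : addCn x (oppCn (addCn y x)) = oppCn y.
Proof. by rewrite /oppCn !addCnE !unvecK opprD addrCA subrr addr0. Qed.

Lemma addCnKl (x y : X) : addCn y (addCn x (oppCn y)) = x.
Proof. by rewrite /oppCn !addCnE !unvecK addrC subrK vecK. Qed.

(* The function [(x, y) |-> f (U x) g (y + U x)] is integrated in two ways:
   directly, and after the translation [x |-> x - U^-1 y]. *)
Lemma integral_linCn_exchange U (f g : X -> \bar R) : U \in unitmx ->
  measurable_fun setT f -> measurable_fun setT g ->
  (forall x, 0 <= f x) -> (forall x, 0 <= g x) ->
  (\int[m]_x f (linCn U x)) * (\int[m]_x g x) =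
  (\int[m]_x g (linCn U x)) * (\int[m]_y f (oppCn y)).
Proof.
move=> Uu mf mg f0 g0.
have mU := measurable_linCn U.
have mfst : measurable_fun setT (fun z : X * X => linCn U z.1).
  exact: (measurableT_comp mU measurable_fst).
have mfU : measurable_fun setT (fun x => f (linCn U x)) by exact: (measurableT_comp mf).
have mgU : measurable_fun setT (fun x => g (linCn U x)) by exact: (measurableT_comp mg).
pose F (z : X * X) := f (linCn U z.1) * g (addCn z.2 (linCn U z.1)).
pose G (z : X * X) := f (addCn (linCn U z.1) (oppCn z.2)) * g (linCn U z.1).
have F0 z : 0 <= F z by rewrite mule_ge0.
have G0 z : 0 <= G z by rewrite mule_ge0.
have mF : measurable_fun setT F.
  apply: emeasurable_funM; first exact: (measurableT_comp mf).
  by apply: (measurableT_comp mg); apply: measurable_addCn => //; exact: measurable_snd.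
have mG : measurable_fun setT G.
  apply: emeasurable_funM; last exact: (measurableT_comp mg).
  apply: (measurableT_comp mf); apply: measurable_addCn => //.
  exact: (measurableT_comp measurable_oppCn measurable_snd).
have E1 : \int[m]_x \int[m]_y F (x, y) = (\int[m]_x f (linCn U x)) * (\int[m]_x g x).
  rewrite -ge0_integralZr//; last exact: integral_ge0.
  apply: eq_integral => x _; rewrite /F /= ge0_integralZl//; last first.
    apply: (measurableT_comp mg); apply: measurable_addCn => //; exact: measurable_cst.
  by rewrite integral_Cn_shift.
have E2 : \int[m]_x \int[m]_y G (x, y) = (\int[m]_x g (linCn U x)) * (\int[m]_y f (oppCn y)).
  rewrite -ge0_integralZr//; last exact: integral_ge0.
  apply: eq_integral => x _; rewrite /G /= ge0_integralZr//; last first.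
    apply: (measurableT_comp mf); apply: measurable_addCn; first exact: measurable_cst.
    exact: measurable_oppCn.
  rewrite muleC; congr (_ * _).
  (* The translation [y |-> y + U x] turns [f (U x - y)] into [f (- y)]. *)
  rewrite -(@integral_Cn_shift _ _
    (fun y => f (addCn (linCn U x) (oppCn y))) (linCn U x))//; last first.
    apply: (measurableT_comp mf); apply: measurable_addCn; first exact: measurable_cst.
    exact: measurable_oppCn.
  by apply: eq_integral => y _; rewrite addCn_opp_shift.
rewrite -E1 -E2 (fubini_tonelli F mF F0) (fubini_tonelli G mG G0).
apply: eq_integral => y _.
rewrite -(@integral_Cn_shift _ _ (fun x => F (x, y)) (linCn (invmx U) (oppCn y))).
- by apply: eq_integral => x _; rewrite /F /G /= !linCn_unitK// addCnKl.
- by apply: (measurableT_comp mF); exact: pair2_measurable.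
- by [].
Qed.

End linear_maps.

(** * Unitary invariance *)

Section unitary_invariance.
Local Open Scope sesquilinear_scope.
Context {R : realType} {n : nat}.
Local Notation X := (Cn R n).
Local Notation m := (lebesgue_Cn R n).
Implicit Types (x : X) (U : 'M[R[i]]_n).

Definition normsq x : R := \sum_(i < n) sqmod (tnth x i).

Lemma normsq_ge0 x : 0 <= normsq x.
Proof. by apply: sumr_ge0 => i _; exact: sqmod_ge0. Qed.

Lemma eucl_normE x : eucl_norm x = Num.sqrt (normsq x).
Proof. by []. Qed.

Lemma punctured_ballP x : punctured_ball x <-> 0 < normsq x <= 1.
Proof.
rewrite /punctured_ball /= eucl_normE sqrtr_gt0; split => /andP[-> /=].
  by rewrite -(@ler_sqr _ _ 1) ?nnegrE ?sqrtr_ge0 ?ler01// sqr_sqrtr ?normsq_ge0// expr1n.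
by move=> x1; rewrite -(sqrtr1 R) ler_sqrt.
Qed.

Lemma diag_form (d : 'rV[R[i]]_n) (v : 'cV[R[i]]_n) :
  complex.Re (inner (diag_mx d *m v) v) =
  \sum_j complex.Re (d 0 j) * sqmod (tnth (unvec v) j).
Proof.
rewrite /inner mxE raddf_sum /=; apply: eq_bigr => j _.
rewrite mul_diag_mx !mxE tnth_mktuple /sqmod /=.
by case: (d 0 j) (v j 0) => a b [e f] /=; ring.
Qed.

Lemma normsqE x : normsq x = complex.Re (inner (vec x) (vec x)).
Proof.
have := diag_form (const_mx 1) (vec x); rewrite diag_const_mx mul1mx vecK => ->.
by apply: eq_bigr => j _; rewrite mxE mul1r.
Qed.

Lemma unitary_form U (d : 'rV[R[i]]_n) x : U \is unitarymx ->
  complex.Re (inner (invmx U *m diag_mx d *m U *m vec x) (vec x)) =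
  \sum_j complex.Re (d 0 j) * sqmod (tnth (linCn U x) j).
Proof.
move=> Uu; rewrite /linCn -diag_form /inner.
have -> : (vec x) ^t* *m (invmx U *m diag_mx d *m U *m vec x) =
    (U *m vec x) ^t* *m (diag_mx d *m (U *m vec x)).
  by rewrite (invmx_unitary Uu) trmx_mul map_mxM !mulmxA.
by [].
Qed.

Lemma normsq_linCn U x : U \is unitarymx -> normsq (linCn U x) = normsq x.
Proof.
move=> Uu; rewrite [RHS]normsqE.
have := unitary_form (const_mx 1) x Uu.
rewrite diag_const_mx mulmx1 (mulVmx (unitarymx_unit Uu)) mul1mx => ->.
by apply: eq_bigr => j _; rewrite mxE mul1r.
Qed.

Definition scaleCn (k : R) x : X := unvec (k%:C *: vec x).

Lemma normalizeE x : normalize x = scaleCn (eucl_norm x)^-1 x.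
Proof.
apply: eq_from_tnth => i; rewrite !tnth_mktuple !mxE /=.
by congr (_, _); ring.
Qed.

Lemma linCn_scale U k x : linCn U (scaleCn k x) = scaleCn k (linCn U x).
Proof. by rewrite /linCn /scaleCn !unvecK -scalemxAr. Qed.

Lemma sqmod_scale k x j : sqmod (tnth (scaleCn k x) j) = k ^+ 2 * sqmod (tnth x j).
Proof. by rewrite tnth_mktuple /sqmod !mxE /=; ring. Qed.

Lemma measure_integral (D : set X) (f : X -> \bar R) : measurable D ->
  (forall x, f x = if `[<D x>] then 1%E else 0%E) -> m D = (\int[m]_x f x)%E.
Proof.
move=> mD fD; rewrite -(setIT D) -integral_indic//.
apply: eq_integral => x _; rewrite fD indicE; case: asboolP => Dx.
  by rewrite mem_set.
by rewrite memNset.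
Qed.

Lemma measure_ball : m (@punctured_ball R n) = (disk_area ^+ n * fine (@simplex_volume R n))%:E.
Proof.
rewrite EFinM fineK ?simplex_volume_fin//.
rewrite -(@integral_form_pair _ _ (nseq_tuple n 0) (@in_unit R)); last 2 first.
- exact: in_unit_ge0.
- exact: measurable_in_unit.
apply: measure_integral; first exact: measurable_punctured_ball.
move=> x; rewrite /in_unit /form_pair /= add0r -/(normsq x).
by congr (if _ then _ else _); apply/idP/asboolP => /punctured_ballP.
Qed.

Lemma measure_ball_gt0 : (0 < n)%N -> 0 < disk_area ^+ n * fine (@simplex_volume R n).
Proof. by move=> n0; rewrite mulr_gt0// ?exprn_gt0 ?disk_area_gt0// simplex_volume_gt0. Qed.

Lemma preimage_unitary_ball U : U \is unitarymx ->
  linCn U @^-1` (@punctured_ball R n) = @punctured_ball R n.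
Proof.
move=> Uu; apply/seteqP; split => x /punctured_ballP xB; apply/punctured_ballP;
  by move: xB; rewrite normsq_linCn.
Qed.

Lemma measure_linCn U (E : set X) : (0 < n)%N -> U \is unitarymx -> measurable E ->
  m (linCn U @^-1` E) = m E.
Proof.
move=> n0 Uu mE.
have mB := @measurable_punctured_ball R n.
have ind0 (D : set X) x : (0 <= (\1_D x)%:E :> \bar R)%E by rewrite lee_fin.
have mind (D : set X) : measurable D -> measurable_fun setT (fun x : X => (\1_D x)%:E : \bar R).
  by move=> mD; apply/measurable_EFinP.
have intE (D : set X) : measurable D -> (\int[m]_x (\1_D x)%:E = m D)%E.
  by move=> mD; rewrite integral_indic// setIT.
have intL V (D : set X) : measurable D ->
    (\int[m]_x (\1_D (linCn V x))%:E = m (linCn V @^-1` D))%E.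
  move=> mD; rewrite -(intE (linCn V @^-1` D)); last first.
    by rewrite -[X in measurable X]setTI; exact: measurable_linCn.
  by apply: eq_integral => x _; rewrite !indicE; congr ((nat_of_bool _)%:R%:E);
    apply/idP/idP; rewrite !inE.
have key V : V \is unitarymx -> (m (linCn V @^-1` E) * m (@punctured_ball R n) =
    m (@punctured_ball R n) * (\int[m]_y (\1_E (oppCn y))%:E))%E.
  move=> Vu; have := integral_linCn_exchange (unitarymx_unit Vu) (mind _ mE) (mind _ mB)
    (ind0 _) (ind0 _).
  by rewrite !intL// intE// preimage_unitary_ball.
have E1 : linCn 1%:M @^-1` E = E.
  by rewrite (_ : linCn _ = id)//; apply/funext => x; rewrite /linCn mul1mx vecK.
(* The right-hand side of [key] does not depend on [V], so [U] is compared with the identity; the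
   volume of the ball, positive and finite, is then divided out. *)
have := key _ Uu; rewrite -(key 1%:M); last first.
  by apply/unitarymxP; rewrite trmx1 map_mx1 mulmx1.
rewrite E1 measure_ball; set c := _ * fine _ => H.
have c0 : c != 0 by rewrite gt_eqF// measure_ball_gt0.
have cK (z : \bar R) : (z * c%:E * (c^-1)%:E = z)%E.
  by rewrite -muleA -EFinM divff// mule1.
by rewrite -[LHS]cK H cK.
Qed.

Lemma measure_half_ball (s : 'I_n -> R) :
  m [set x | punctured_ball x /\ 0 < \sum_j s j * sqmod (tnth x j)] =
  ((disk_area ^+ n)%:E * tail_volume s)%E.
Proof.
pose t := [tuple s i | i < n].
rewrite -(@integral_form_pair _ _ t (@pos_in_unit R) (0, 0)); last 2 first.
- exact: pos_in_unit_ge0.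
- exact: measurable_pos_in_unit.
have E x : (form_pair t (0, 0) x).1 = \sum_j s j * sqmod (tnth x j).
  by rewrite /form_pair /= add0r; apply: eq_bigr => i _; rewrite tnth_mktuple.
have E2 x : (form_pair t (0, 0) x).2 = normsq x by rewrite /form_pair /= add0r.
apply: measure_integral.
  rewrite (_ : mkset _ = @punctured_ball R n `&`
    (fst \o form_pair t (0, 0)) @^-1` `]0, +oo[%classic).
    apply: measurableI; first exact: measurable_punctured_ball.
    rewrite -[X in measurable X]setTI.
    by apply: (measurableT_comp measurable_fst (measurable_form_pair t (0, 0))).
  have PE x : ((fst \o form_pair t (0, 0)) @^-1` `]0, +oo[%classic) x =
      (0 < \sum_j s j * sqmod (tnth x j)) :> Prop.
    by rewrite -(E x) /preimage /mkset /= in_itv /= andbT.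
  by apply/seteqP; split => x [xB xs]; split => //; [rewrite PE|rewrite -PE].
move=> x; rewrite /pos_in_unit /in_unit E E2.
case: asboolP => [[/punctured_ballP -> ->//]|].
by case: ifP => // s0; case: ifP => // /punctured_ballP xB []; split.
Qed.

Lemma measure_null_cone (s : 'I_n -> R) : (exists j, s j != 0) ->
  m [set x | punctured_ball x /\ \sum_j s j * sqmod (tnth x j) = 0] = 0%E.
Proof.
move=> [j sj]; pose t := [tuple s i | i < n].
transitivity ((disk_area ^+ n)%:E * dirints t (@null_in_unit R) (0%R, 0%R))%E; last first.
  rewrite dirints_null_in_unit ?mule0//; apply/hasP; exists (s j) => //.
  by apply/mapP; exists j; rewrite ?mem_enum.
rewrite -(@integral_form_pair _ _ t (@null_in_unit R) (0, 0)); last 2 first.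
- exact: null_in_unit_ge0.
- exact: measurable_null_in_unit.
have E x : (form_pair t (0, 0) x).1 = \sum_j s j * sqmod (tnth x j).
  by rewrite /form_pair /= add0r; apply: eq_bigr => i _; rewrite tnth_mktuple.
have E2 x : (form_pair t (0, 0) x).2 = normsq x by rewrite /form_pair /= add0r.
apply: measure_integral.
  rewrite (_ : mkset _ = @punctured_ball R n `&`
    (fst \o form_pair t (0, 0)) @^-1` [set 0]).
    apply: measurableI; first exact: measurable_punctured_ball.
    rewrite -[X in measurable X]setTI.
    by apply: (measurableT_comp measurable_fst (measurable_form_pair t (0, 0))).
  have PE x : ((fst \o form_pair t (0, 0)) @^-1` [set 0]) x =
      (\sum_j s j * sqmod (tnth x j) = 0) :> Prop by rewrite -(E x).
  by apply/seteqP; split => x [xB xs]; split => //; [rewrite PE|rewrite -PE].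
move=> x; rewrite /null_in_unit /in_unit E E2.
case: asboolP => [[/punctured_ballP -> /eqP ->//]|].
by case: ifP => // /eqP s0; case: ifP => // /punctured_ballP xB []; split.
Qed.

End unitary_invariance.

(** * The tails of the numerical measure *)

Lemma char_poly_similar (F : comUnitRingType) n (P D : 'M[F]_n) : P \in unitmx ->
  char_poly (invmx P *m D *m P) = char_poly D.
Proof.
move=> Pu; rewrite /char_poly /char_poly_mx.
pose Q := map_mx (@polyC F) P; pose Q' := map_mx (@polyC F) (invmx P).
have QK : Q' *m Q = 1%:M by rewrite -map_mxM mulVmx// map_mx1.
have -> : 'X%:M - map_mx polyC (invmx P *m D *m P) =
    Q' *m ('X%:M - map_mx polyC D) *m Q.
  rewrite mulmxBr mulmxBl !map_mxM; congr (_ - _).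
  by rewrite scalar_mxC -mulmxA QK mulmx1.
by rewrite !det_mulmx mulrAC -det_mulmx QK det1 mul1r.
Qed.

Section numerical_tail.
Local Open Scope sesquilinear_scope.
Context {R : realType} {n : nat}.
Variables (A : 'M[R[i]]_n) (lambda : 'rV[R]_n).
Hypothesis hermA : A \is hermsymmx.
Hypothesis charA : char_poly A = \prod_(j < n) ('X - ((lambda 0 j)%:C)%:P).
Local Notation X := (Cn R n).
Local Notation m := (lebesgue_Cn R n).

(** The knots are given through the characteristic polynomial alone, so they match the diagonal only
    up to a permutation, to which volumes of tails are insensitive by [perm_dirints]. *)
Lemma spectral_decomposition : exists U (d : 'rV[R[i]]_n),
  [/\ U \is unitarymx, A = invmx U *m diag_mx d *m U &
   perm_eq [seq d 0 j | j <- enum 'I_n] [seq (lambda 0 j)%:C | j <- enum 'I_n]].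
Proof.
have /hermitian_normalmx /orthomx_spectralP AE := hermA.
exists (spectralmx A), (spectral_diag A); split => //; first exact: spectral_unitarymx.
have E : \prod_(i < n) ('X - (diag_mx (spectral_diag A) i i)%:P) =
    \prod_(j < n) ('X - ((lambda 0 j)%:C)%:P).
  transitivity (char_poly (diag_mx (spectral_diag A))).
    exact/esym/char_poly_trig/diag_mx_is_trig.
  rewrite -charA -(char_poly_similar _ (spectral_unit A)).
  by apply: (congr1 (fun M => char_poly M)); rewrite -AE.
have B (f : 'I_n -> R[i]) : \prod_(x <- [seq f j | j <- enum 'I_n]) ('X - x%:P) =
    \prod_(j < n) ('X - (f j)%:P) by rewrite big_map big_enum.
apply: prod_XsubC_eq; rewrite !B -E.
by apply: eq_bigr => j _; rewrite mxE eqxx mulr1n.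
Qed.

Lemma nonscalar_knots : ~~ is_scalar_mx A -> exists i j, lambda 0 i != lambda 0 j.
Proof.
move=> nsA; apply/not_existsP => H; move/negP: nsA; apply.
have [U [d [Uu AE pd]]] := spectral_decomposition.
have [n0|n0] := posnP n.
  by apply/is_scalar_mxP; exists 0; apply/matrixP => i; have := ltn_ord i; rewrite {2}n0.
pose i0 := Ordinal n0.
have lE i : lambda 0 i = lambda 0 i0.
  by apply/eqP/negPn/negP => ne; apply: (H i); exists i0.
have dE j : d 0 j = (lambda 0 i0)%:C.
  have : d 0 j \in [seq (lambda 0 j)%:C | j <- enum 'I_n].
    by rewrite -(perm_mem pd); apply/mapP; exists j; rewrite ?mem_enum.
  by case/mapP => k _ ->; rewrite lE.
apply/is_scalar_mxP; exists (lambda 0 i0)%:C; rewrite AE.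
have -> : d = const_mx (lambda 0 i0)%:C.
  by apply/matrixP => i j; rewrite mxE ord1 dE.
by rewrite diag_const_mx scalar_mxC -mulmxA mulVmx ?mulmx1// unitarymx_unit.
Qed.

Lemma perm_real_knots (d : 'rV[R[i]]_n) :
  perm_eq [seq d 0 j | j <- enum 'I_n] [seq (lambda 0 j)%:C | j <- enum 'I_n] ->
  forall t, perm_eq [seq complex.Re (d 0 j) - t | j <- enum 'I_n]
                    [seq lambda 0 j - t | j <- enum 'I_n].
Proof.
move=> pd t; have := perm_map (fun z => complex.Re z - t) pd.
by rewrite -!map_comp.
Qed.

Lemma numerical_measureE (D : set (measurableTypeR R)) : (0 < n)%N ->
  numerical_measure A D =
  (m [set x | punctured_ball x /\ D (quad_form A (normalize x))] *
   ((disk_area ^+ n * fine (@simplex_volume R n))^-1)%:E)%E.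
Proof.
move=> n0; rewrite /numerical_measure /distribution /pushforward /=.
rewrite /sphere_measure /distribution /pushforward /= /uniform_ball /mnormalize /=.
rewrite /mrestr setTI measure_ball.
rewrite eqe gt_eqF ?measure_ball_gt0//=.
congr (_ * _)%E; congr (m _).
by apply/seteqP; split => x /= [].
Qed.

Lemma quad_form_sub U (d : 'rV[R[i]]_n) t x : U \is unitarymx ->
  A = invmx U *m diag_mx d *m U -> punctured_ball x ->
  quad_form A (normalize x) - t =
  (\sum_j (complex.Re (d 0 j) - t) * sqmod (tnth (linCn U x) j)) / normsq x.
Proof.
move=> Uu AE /punctured_ballP /andP[x0 _].
have x0' : normsq x != 0 by rewrite gt_eqF.
rewrite /quad_form {1}AE unitary_form// normalizeE.
under eq_bigr => j _ do rewrite linCn_scale sqmod_scale mulrCA.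
rewrite -mulr_sumr eucl_normE exprVn sqr_sqrtr ?ltW//.
under [in RHS]eq_bigr => j _ do rewrite mulrBl.
rewrite sumrB -mulr_sumr -/(normsq (linCn U x)) normsq_linCn// mulrBl mulfK//.
by rewrite mulrC.
Qed.

Lemma measurable_weighted_pos (s : 'I_n -> R) (I : set (measurableTypeR R)) : measurable I ->
  measurable [set x : X | punctured_ball x /\ I (\sum_j s j * sqmod (tnth x j))].
Proof.
move=> mI; apply: measurableI; first exact: measurable_punctured_ball.
have : measurable_fun setT (fun x : X => \sum_j s j * sqmod (tnth x j) : measurableTypeR R).
  apply: measurable_sum => j; apply: measurable_funM; first exact: measurable_cst.
  by apply: (measurableT_comp measurable_sqmod); exact: measurable_tnth.
by move=> mf; rewrite -[X in measurable X]setTI; exact: mf.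
Qed.

(** A condition stable under positive scaling can be tested before the division by [normsq x], and
    unitary invariance then replaces [linCn U x] by [x]. It serves for open half-lines, with [I] the
    positive reals, and for points, with [I] reduced to 0. *)
Lemma numerical_measure_cone (t : R) (D I : set (measurableTypeR R)) :
  (0 < n)%N -> measurable I ->
  (forall y, D y = I (y - t)) -> (forall y k, 0 < k -> I (y / k) = I y) ->
  exists s : 'I_n -> R, perm_eq [seq s j | j <- enum 'I_n] [seq lambda 0 j - t | j <- enum 'I_n] /\
  numerical_measure A D =
  (m [set x | punctured_ball x /\ I (\sum_j s j * sqmod (tnth x j))%R] *
   ((disk_area ^+ n * fine (@simplex_volume R n))^-1)%:E)%E.
Proof.
move=> n0 mI DI coneI; have [U [d [Uu AE pd]]] := spectral_decomposition.
exists (fun j => complex.Re (d 0 j) - t); split; first exact: perm_real_knots.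
rewrite numerical_measureE//; congr (_ * _)%E.
rewrite -[RHS](measure_linCn n0 Uu); last exact: measurable_weighted_pos.
congr (m _).
have PB x : punctured_ball (linCn U x) = punctured_ball x.
  exact: (congr1 (fun B => B x) (preimage_unitary_ball Uu)).
apply/seteqP; split => x [xB]; rewrite /preimage /mkset ?PB.
  rewrite DI (quad_form_sub _ Uu AE xB) coneI; first by [].
  by case/punctured_ballP/andP: xB.
move: xB; rewrite PB => xB Is; split => //; rewrite DI (quad_form_sub _ Uu AE xB) coneI//.
by case/punctured_ballP/andP: xB.
Qed.

Lemma numerical_measure_tail t : (0 < n)%N ->
  numerical_measure A `]t, +oo[%classic = (tail (fun j => lambda 0 j - t))%:E.
Proof.
move=> n0.
have [|||s [ps ->]] := @numerical_measure_cone t `]t, +oo[%classic `]0, +oo[%classic n0 _.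
- by [].
- by move=> y; rewrite /= !in_itv /= !andbT subr_gt0.
- by move=> y k k0; rewrite /= !in_itv /= !andbT pmulr_lgt0// invr_gt0.
rewrite (_ : [set x | _] = [set x : X | punctured_ball x /\
    0 < \sum_j s j * sqmod (tnth x j)]); last first.
  by apply/seteqP; split => x /=; rewrite in_itv /= andbT.
rewrite measure_half_ball.
have -> : tail_volume s = tail_volume (fun j => lambda 0 j - t).
  apply: (congr1 (fun f => f (0, 0))); apply: perm_dirints => //.
    exact: pos_in_unit_ge0.
  exact: measurable_pos_in_unit.
rewrite -(fineK (tail_volume_fin _)) -!EFinM /tail; congr EFin.
have c0 : disk_area ^+ n != 0 :> R by rewrite gt_eqF// exprn_gt0// disk_area_gt0.
by rewrite invfM mulrACA mulfV// mul1r.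
Qed.

Lemma numerical_measure_point t : ~~ is_scalar_mx A ->
  numerical_measure A [set t] = 0%E.
Proof.
move=> nsA; have [i [j ij]] := nonscalar_knots nsA.
have n0 : (0 < n)%N by rewrite (leq_trans _ (ltn_ord i)).
have [|||s [ps ->]] := @numerical_measure_cone t [set t] [set 0] n0 _.
- exact: measurable_set1.
- by move=> y; apply/propext; split => /= [->|/eqP]; rewrite ?subrr// subr_eq0 => /eqP.
- move=> y k k0; apply/propext; split => /= [/eqP|->]; last by rewrite mul0r.
  by rewrite mulf_eq0 invr_eq0 (gt_eqF k0) orbF => /eqP.
rewrite measure_null_cone ?mul0e//.
apply: contrapT => /forallNP s0; move/eqP: ij; apply.
have l0 k : lambda 0 k = t.
  have : lambda 0 k - t \in [seq s j | j <- enum 'I_n].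
    by rewrite (perm_mem ps); apply/mapP; exists k; rewrite ?mem_enum.
  case/mapP => l _ sl; apply/eqP; rewrite -subr_eq0 sl.
  by apply/negPn/negP; exact: s0.
by rewrite !l0.
Qed.

End numerical_tail.

(** * Measures given by densities off finitely many points *)

Section measures_off_knots.
Context {R : realType}.
Local Notation T := (measurableTypeR R).
Variables m1 m2 : {measure set T -> \bar R}.

Lemma eq_measure_bigcup (F : (set T)^nat) : (forall i, measurable (F i)) ->
  nondecreasing_seq F -> (forall i, m1 (F i) = m2 (F i)) ->
  m1 (\bigcup_i F i) = m2 (\bigcup_i F i).
Proof.
move=> mF ndF EF.
have mU : measurable (\bigcup_i F i) by exact: bigcupT_measurable.
have c1 := nondecreasing_cvg_mu (mu := m1) mF mU ndF.
have c2 := nondecreasing_cvg_mu (mu := m2) mF mU ndF.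
apply: cvg_unique c1 _; first exact: ereal_hausdorff.
by rewrite (_ : m1 \o F = m2 \o F)//; apply/funext.
Qed.

Hypotheses (m10 : forall x : R, m1 [set x] = 0%E) (m20 : forall x : R, m2 [set x] = 0%E).

Lemma eq_measure_open_itv (a b : R) :
  (forall c d, a < c -> c < d -> d < b -> m1 `[c, d]%classic = m2 `[c, d]%classic) ->
  m1 `]a, b[%classic = m2 `]a, b[%classic.
Proof.
move=> E.
have inv (i j : nat) : (i <= j)%N -> j.+1%:R^-1 <= i.+1%:R^-1 :> R.
  by move=> ij; rewrite lef_pV2 ?posrE// ler_nat.
rewrite itv_bnd_open_bigcup; apply: eq_measure_bigcup => //.
  move=> i j ij; apply/subsetPset => x /=; rewrite !in_itv /= => /andP[-> /= xi].
  by rewrite (le_trans xi)// lerB// inv.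
move=> i; rewrite itv_open_bnd_bigcup; apply: eq_measure_bigcup => //.
  move=> j k jk; apply/subsetPset => x /=; rewrite !in_itv /= => /andP[xj ->].
  by rewrite andbT (le_trans _ xj)// lerD2l inv.
(* For small [i] and [j] the truncated segment may be empty or a single point; points are null for
   both measures. *)
move=> j; have [cd|cd|->] := ltgtP (a + j.+1%:R^-1) (b - i.+1%:R^-1).
- by apply: E => //; rewrite ?ltrDl ?gtrBl ?invr_gt0 ?ltr0n.
- by rewrite set_itv_ge ?measure0// bnd_simp -ltNge.
- by rewrite set_itv1 m10 m20.
Qed.

Lemma measure_split_ocitv (m : {measure set T -> \bar R}) (a c b : R) : a < c -> c < b ->
  (m `]a, b]%classic = m `]a, c]%classic + m `]c, b]%classic)%E.
Proof.
move=> ac cb; rewrite -measureU//; last first.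
  rewrite -subset0 => x [] /=; rewrite !in_itv /= => /andP[_ xc] /andP[cx _].
  by rewrite ltNge xc in cx.
congr (m _); apply/seteqP; split => x /=; rewrite !in_itv /=.
  by move=> /andP[-> ->]; rewrite andbT /=; have [?|?] := leP x c; [left|right].
by move=> [|] /andP[xa xb]; apply/andP; split; lra.
Qed.

Lemma eq_measure_ocitv_off (K : seq R) (a b : R) : a < b ->
  (forall c d : R, a < c -> c < d -> d < b -> (forall x, c <= x <= d -> x \notin K) ->
    m1 `[c, d]%classic = m2 `[c, d]%classic) ->
  m1 `]a, b]%classic = m2 `]a, b]%classic.
Proof.
elim: K a b => [|k K IH] a b ab E.
  have U1 : `]a, b]%classic = `]a, b[%classic `|` [set b] :> set R.
    by rewrite setUitv1// bnd_simp.
  have dis : `]a, b[%classic `&` [set b] = set0 :> set R.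
    by rewrite -subset0 => x [] /=; rewrite in_itv /= => /andP[_ xb] xE; rewrite xE ltxx in xb.
  rewrite U1 !measureU//; try exact: measurable_set1.
  congr (_ + _)%E; last exact: (etrans (m10 b) (esym (m20 b))).
  by apply: eq_measure_open_itv => c d ac cd db; exact: E.
have [/andP[ak kb]|kab] := boolP (a < k < b); last first.
  apply: IH => // c d ac cd db KE; apply: E => // x xcd; rewrite inE negb_or KE// andbT.
  by apply: contraNneq kab => <-; apply/andP; split; lra.
rewrite !(measure_split_ocitv _ ak kb); congr (_ + _)%E; apply: IH => //.
  move=> c d ac cd dk KE; apply: E => //; first lra.
  by move=> x xcd; rewrite inE negb_or KE// andbT; lra.
move=> c d ac cd dk KE; apply: E => //; first lra.
by move=> x xcd; rewrite inE negb_or KE// andbT; lra.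
Qed.

Lemma eq_measure_off (K : seq R) :
  (forall c d : R, c < d -> (forall x, c <= x <= d -> x \notin K) ->
    m1 `[c, d]%classic = m2 `[c, d]%classic) ->
  (forall k : R, (m1 `](- k)%R, k]%classic < +oo)%E) ->
  forall A, measurable A -> m1 A = m2 A.
Proof.
move=> E fin A mA.
have U := @measure_unique _ R T (@ocitv R) (fun k => `](- k%:R), k%:R]%classic : set T)
  _ _ _ _ m1 m2.
apply: U mA => //.
- exact: ocitvI.
- by move=> k; exists (- k%:R, k%:R).
- exact: bigcup_itvT.
- move=> _ /ocitvP[->|[[a b] /= ab ->]]; first by rewrite !measure0.
  by apply: (@eq_measure_ocitv_off K) => // c d _ cd _; exact: E.
Qed.

End measures_off_knots.

Section density_measure.
Context d (T : measurableType d) (R : realType).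
Variables (mu : {measure set T -> \bar R}) (f : T -> \bar R).
Hypotheses (mf : measurable_fun setT f) (f0 : forall x, (0 <= f x)%E).

(* The proofs are arguments so that the measure structure can be attached. *)
Definition density_measure of measurable_fun setT f & (forall x, (0 <= f x)%E) :
  set T -> \bar R := fun A => (\int[mu]_(x in A) f x)%E.

Let density_measure0 : density_measure mf f0 set0 = 0%E.
Proof. exact: integral_set0. Qed.

Let density_measure_ge0 A : (0 <= density_measure mf f0 A)%E.
Proof. by apply: integral_ge0 => x _; exact: f0. Qed.

Let density_measure_sigma_additive : semi_sigma_additive (density_measure mf f0).
Proof. exact: semi_sigma_additive_nng_induced. Qed.

HB.instance Definition _ := isMeasure.Build _ _ _ (density_measure mf f0)
  density_measure0 density_measure_ge0 density_measure_sigma_additive.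

End density_measure.

(** * The B-spline as a function of its knots *)

Section spline_function.
Context {R : realType} {n : nat}.
Implicit Types (l : 'rV[R]_n) (x : R) (i j k : 'I_n).

Definition knot_shift l x k : R := l 0 k - x.

Definition knots l : seq R := [seq l 0 k | k <- enum 'I_n].

Lemma knot_shift_neq0 l x k : x \notin knots l -> knot_shift l x k != 0.
Proof.
apply: contraNneq => /eqP; rewrite subr_eq0 => /eqP <-.
by apply/mapP; exists k; rewrite ?mem_enum.
Qed.

(* Whenever [l 0 i != l 0 j] this is the B-spline (see [BsplineE]), in a form that
   is continuous in [l] also at repeated knots. *)
Definition spline_fun l i j x : R :=
  n.-1%:R * ((subtail (finset.setT :\ j) (knot_shift l x) -
              subtail (finset.setT :\ i) (knot_shift l x)) / (l 0 i - l 0 j)).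

Lemma divdiff_distinctE l x i j : i != j -> distinct_knots l -> x \notin knots l ->
  n.-1%:R * divdiff_distinct (truncated_power n.-2 x) l = spline_fun l i j x.
Proof.
move=> ij dl xl; rewrite /spline_fun; congr (_ * _).
have ia : injective (knot_shift l x) by move=> k k' /addIr /dl.
have d0 : l 0 i - l 0 j != 0 by rewrite subr_eq0; apply: contra_neq ij => /dl.
rewrite -(divsum_subtail ia (fun k => knot_shift_neq0 k xl) ij).
have -> : knot_shift l x i - knot_shift l x j = l 0 i - l 0 j.
  by rewrite /knot_shift opprB addrA subrK.
rewrite mulrC mulKf// /divdiff_distinct /divsum; apply: eq_big => [k|k _].
  by rewrite inE.
congr (_ / _).
  by rewrite /truncated_power /pospow subr_gt0.
apply: eq_big => [k'|k' _]; first by rewrite !inE andbT.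
by rewrite /knot_shift opprB addrA subrK.
Qed.

Lemma cvg_spline_fun (F : set_system 'rV[R]_n) {FF : Filter F} l i j x :
  (forall k, (fun l' : 'rV[R]_n => l' 0 k) @ F --> l 0 k) -> l 0 i != l 0 j -> x \notin knots l ->
  spline_fun l' i j x @[l' --> F] --> spline_fun l i j x.
Proof.
move=> cl ij xl.
have ca k : knot_shift l' x k @[l' --> F] --> knot_shift l x k.
  exact: (cvgB (cl k) (cvg_cst x)).
apply: cvgM; first exact: cvg_cst.
apply: cvgM.
  by apply: cvgB; apply: cvg_subtail => // k _; exact: knot_shift_neq0.
by apply: cvgV; [rewrite subr_eq0|exact: (cvgB (cl i) (cl j))].
Qed.

(** Adding [e * k] to the [k]-th knot separates equal knots for every [e != 0] and keeps different
    knots apart for small [e]. Hence the filter defining [divdiff] at repeated knots is proper and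
    its limit is unique. *)
Lemma closure_distinct_knots l : closure (@distinct_knots R n) l.
Proof.
pose p (e : R) : 'rV[R]_n := \row_k (l 0 k + e * k%:R).
have pc k : p e 0 k @[e --> (0 : R)^'] --> l 0 k.
  have -> : (fun e => p e 0 k) = (fun e : R => l 0 k + e * k%:R).
    by apply/funext => e; rewrite mxE.
  have E0 : l 0 k = l 0 k + 0 * k%:R by rewrite mul0r addr0.
  rewrite [X in _ --> X]E0; apply: cvgD; first exact: cvg_cst.
  apply: cvgM; last exact: cvg_cst.
  exact: nbhs_dnbhs.
have pd : \forall e \near (0 : R)^', distinct_knots (p e).
  have : \forall e \near (0 : R)^', forall ij : 'I_n * 'I_n, ij.1 != ij.2 ->
      p e 0 ij.1 != p e 0 ij.2.
    apply: filter_forall => -[i j] /=; have [->|ij] := eqVneq i j.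
      exact: nearW.
    have [lij|lij] := eqVneq (l 0 i) (l 0 j).
      have : \forall e \near (0 : R)^', e != 0 by exact: nbhs_dnbhs_neq.
      apply: filterS => e e0 _; rewrite !mxE lij (inj_eq (addrI _)).
      by rewrite (inj_eq (mulfI e0)) eqr_nat.
    have d0 : l 0 i - l 0 j != 0 by rewrite subr_eq0.
    apply: filterS (cvgr_neq0 _ (cvgB (pc i) (pc j)) d0) => e H _.
    by rewrite -subr_eq0.
  apply: filterS => e H i j eij; apply/eqP/negPn/negP => ij.
  by have := H (i, j) ij; rewrite /= eij eqxx.
move=> B [P Pn PB].
have pP : \forall e \near (0 : R)^', forall k, P 0 k (p e 0 k).
  by apply: filter_forall => k; apply: pc; exact: Pn.
have [e [de Be]] : exists e : R, distinct_knots (p e) /\ forall k, P 0 k (p e 0 k).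
  by apply: (@filter_ex _ (0 : R)^'); exact: filterI pd pP.
by exists (p e); split => //; apply: PB => i k; rewrite ord1.
Qed.

(** Near [l] the indices [i] and [j] keep different knots, so on distinct knots the divided
    difference is [spline_fun] divided by [n.-1], and [spline_fun] is continuous at [l]. The
    division is legitimate since two indices force [n >= 2]. *)
Lemma BsplineE l i j x : l 0 i != l 0 j -> x \notin knots l ->
  Bspline l x = spline_fun l i j x.
Proof.
move=> lij xl; have ij : i != j by apply: contra_neq lij => ->.
rewrite /Bspline /divdiff; case: asboolP => dl; first exact: divdiff_distinctE.
have n1 : n.-1%:R != 0 :> R.
  have n2 : (1 < #|'I_n|)%N by apply/card_gt1P; exists i, j.
  by rewrite card_ord in n2; rewrite pnatr_eq0 -lt0n -subn1 subn_gt0.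
set F := within (@distinct_knots R n) (nbhs l).
have FP : ProperFilter F by apply: within_nbhs_proper; exact: closure_distinct_knots.
have cl k : (fun l' : 'rV[R]_n => l' 0 k) @ F --> l 0 k.
  move=> B nB; have := @coord_continuous R 1 n 0 k l B nB.
  by apply: (@filterS _ _ (nbhs_filter l)) => l' Hl' _.
have C : divdiff_distinct (truncated_power n.-2 x) l' @[l' --> F]
    --> n.-1%:R^-1 * spline_fun l i j x.
  have H : n.-1%:R^-1 * spline_fun l' i j x @[l' --> F] --> n.-1%:R^-1 * spline_fun l i j x.
    by apply: cvgM; [exact: cvg_cst|exact: cvg_spline_fun].
  apply: cvg_trans H; apply: near_eq_cvg.
  have nl : \forall l' \near F, x \notin knots l'.
    have : \forall l' \near F, forall k, (l' : 'rV[R]_n) 0 k - x != 0.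
      apply: filter_forall => k; apply: (@cvgr_neq0 _ _ _ _ _ _ (l 0 k - x)).
        exact: (cvgB (cl k) (cvg_cst x)).
      exact: (knot_shift_neq0 k xl).
    apply: filterS => l' H'; apply/mapP => -[k _ xk].
    by have := H' k; rewrite -xk subrr eqxx.
  have nd : \forall l' \near F, distinct_knots l' by exact: withinT.
  apply: filterS2 nl nd => l' xl' dl' /=.
  by rewrite -(divdiff_distinctE ij dl' xl') mulKf.
rewrite (cvg_lim _ C)//.
by rewrite mulVKf.
Qed.

(** [subtail_exchange] eliminates the tail of the full set from the derivative, leaving a difference
    quotient in the knots [i] and [j]. *)
Lemma is_derive_subtailT l i j x : l 0 i != l 0 j -> x \notin knots l ->
  is_derive x 1 (fun y => subtail finset.setT (knot_shift l y)) (- spline_fun l i j x).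
Proof.
move=> lij xl; have a0 k := knot_shift_neq0 k xl.
apply: (is_derive_eq (@is_derive_subtail R n finset.setT (l 0) x i
  (fun k _ => a0 k) (finset.in_setT i))).
rewrite finset.cardsT card_ord /spline_fun mulNr; congr (- (_ * _)).
have d0 : l 0 i - l 0 j != 0 by rewrite subr_eq0.
have := @subtail_exchange R n finset.setT (knot_shift l x) i j (fun k _ => a0 k)
  (finset.in_setT _) (finset.in_setT _).
rewrite -/(knot_shift l x) -/(knot_shift l x i).
have -> : l 0 i - l 0 j = knot_shift l x i - knot_shift l x j.
  by rewrite /knot_shift opprB addrA subrK.
move: (d0); have -> : l 0 i - l 0 j = knot_shift l x i - knot_shift l x j.
  by rewrite /knot_shift opprB addrA subrK.
move: (a0 i); rewrite -/(knot_shift l x).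
move: (knot_shift l x i) (knot_shift l x j) => A B.
move: (subtail finset.setT _) => G.
move: (subtail (finset.setT :\ j) _) => u; move: (subtail (finset.setT :\ i) _) => w.
move=> A0 AB0 H; apply/eqP; rewrite eqr_div//; apply/eqP; move: H; lra.
Qed.

Lemma near_notin_knots l x : x \notin knots l -> \forall y \near x, y \notin knots l.
Proof.
move=> xl; have : \forall y \near x, forall k : 'I_n, l 0 k - y != 0.
  apply: (@filter_forall _ _ (fun k y => l 0 k - y != 0) (nbhs x)) => k.
  apply: (@cvgr_neq0 _ _ _ _ _ _ (l 0 k - x)).
    exact: (cvgB (cvg_cst (l 0 k)) cvg_id).
  exact: (knot_shift_neq0 k xl).
apply: filterS => y H; apply/mapP => -[k _ yk].
by have := H k; rewrite -yk subrr eqxx.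
Qed.

Lemma continuous_spline_fun l i j x : x \notin knots l ->
  {for x, continuous (spline_fun l i j)}.
Proof.
move=> xl.
have ca k : knot_shift l y k @[y --> x] --> knot_shift l x k.
  exact: (cvgB (cvg_cst (l 0 k)) cvg_id).
apply: cvgM; first exact: cvg_cst.
apply: cvgM; last exact: cvg_cst.
by apply: cvgB; apply: cvg_subtail => // k _; exact: knot_shift_neq0.
Qed.

(** The spline is minus the derivative of the tail, so its sign comes from monotonicity, which in
    turn is monotonicity of the numerical measure. *)
Lemma spline_fun_ge0 l i j x : l 0 i != l 0 j -> x \notin knots l ->
  {homo (fun y => subtail finset.setT (knot_shift l y)) : y z /~ y <= z} ->
  0 <= spline_fun l i j x.
Proof.
move=> lij xl ni; have D := is_derive_subtailT lij xl.
rewrite -oppr_le0 -(@derive_val _ _ _ _ _ _ _ D).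
have dG : derivable (fun y => subtail finset.setT (knot_shift l y)) x 1 by exact: ex_derive.
rewrite /derive; apply: limr_le; first exact: dG.
have : \forall h \near (0 : R)^', h != 0 by exact: nbhs_dnbhs_neq.
apply: filterS => h h0 /=; rewrite /GRing.scale /= mulr1.
have [hp|hn|hE] := ltgtP h 0; last by rewrite hE eqxx in h0.
  by rewrite mulr_le0_ge0 ?invr_le0 ?(ltW hp)// subr_ge0; apply: ni; rewrite gerDr ltW.
by rewrite mulr_ge0_le0 ?invr_ge0 ?(ltW hn)// subr_le0; apply: ni; rewrite lerDr ltW.
Qed.

Lemma integral_spline_fun l i j (a b : R) : l 0 i != l 0 j -> a < b ->
  (forall x, a <= x <= b -> x \notin knots l) ->
  (\int[@lebesgue_measure R]_(x in `[a, b]) (spline_fun l i j x)%:E =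
   (subtail finset.setT (knot_shift l a))%:E - (subtail finset.setT (knot_shift l b))%:E)%E.
Proof.
move=> lij ab K; pose F y := - subtail finset.setT (knot_shift l y).
have DF x : a <= x <= b -> is_derive x 1 F (spline_fun l i j x).
  move=> /K xl; rewrite -[X in is_derive _ _ _ X]opprK.
  by apply: is_deriveN; exact: is_derive_subtailT.
have cF x : a <= x <= b -> {for x, continuous F}.
  move=> /DF D; apply: differentiable_continuous; apply/derivable1_diffP.
  exact: ex_derive.
rewrite (@continuous_FTC2 _ (spline_fun l i j) F a b)//.
- by rewrite -!EFinB /F; congr EFin; ring.
- apply: continuous_in_subspaceT => x; rewrite inE /= in_itv /= => /K.
  exact: continuous_spline_fun.
- split.
  + move=> x; rewrite in_itv /= => /andP[ax xb].
    have D := DF x; rewrite !ltW// in D.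
    by apply: ex_derive; exact: D.
  + by apply: cvg_at_right_filter; apply: cF; rewrite lexx ltW.
  + by apply: cvg_at_left_filter; apply: cF; rewrite lexx ltW.
- move=> x; rewrite in_itv /= => /andP[ax xb].
  by rewrite derive1E; apply: derive_val; apply: DF; rewrite !ltW.
Qed.

(** At the knots, where the sign and the continuity of [spline_fun] are not controlled, the value 0
    gives a function nonnegative everywhere, as [density_measure] demands. *)
Definition spline_density l i j (x : R) : \bar R :=
  if x \in knots l then 0%E else (spline_fun l i j x)%:E.

Lemma measurable_spline_density l i j :
  measurable_fun setT (spline_density l i j : measurableTypeR R -> \bar R).
Proof.
have oU : open [set x | x \notin knots l].
  rewrite openE => x /= xl; exact: near_notin_knots.
have mU : measurable_fun [set x | x \notin knots l] (spline_fun l i j).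
  apply: open_continuous_measurable_fun => // x; rewrite inE /=.
  exact: continuous_spline_fun.
rewrite (_ : spline_density l i j = (EFin \o spline_fun l i j) \_ [set x | x \notin knots l]).
  have mD : measurable ([set x | x \notin knots l] : set (measurableTypeR R)).
    exact: open_measurable.
  by apply/(measurable_restrictT _ mD); apply/measurable_EFinP.
apply/funext => x; rewrite /spline_density patchE.
have [xl|xl] := boolP (x \in knots l); first by rewrite memNset//= xl.
by rewrite mem_set.
Qed.

End spline_function.

(** * The numerical density *)

Section numerical_density_spline.
Local Open Scope charge_scope.
Context {R : realType} {n : nat}.
Variables (A : 'M[R[i]]_n) (lambda : 'rV[R]_n) (i j : 'I_n).
Hypothesis hermA : A \is hermsymmx.
Hypothesis nsA : ~~ is_scalar_mx A.
Hypothesis charA : char_poly A = \prod_(j < n) ('X - ((lambda 0 j)%:C)%:P).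
Hypothesis lij : lambda 0 i != lambda 0 j.
Local Notation leb := (@lebesgue_measure R).
Local Notation T := (measurableTypeR R).
Local Notation nu := (numerical_measure A).
Local Notation G := (fun y => subtail finset.setT (knot_shift lambda y)).

Let n0 : (0 < n)%N. Proof. exact: leq_trans (ltn_ord i). Qed.

Lemma numerical_tailE y : nu `]y, +oo[%classic = (G y)%:E.
Proof.
rewrite (numerical_measure_tail hermA charA)//; congr EFin; rewrite /subtail.
by congr tail; apply/funext => k; rewrite inE.
Qed.

Lemma tail_nincr : {homo G : y z /~ y <= z}.
Proof.
move=> y z zy; rewrite -lee_fin -!numerical_tailE; apply: le_measure; rewrite ?inE//.
by move=> x /=; rewrite !in_itv /= !andbT; exact: le_lt_trans.
Qed.

Lemma spline_density_ge0 x : (0 <= spline_density lambda i j x)%E.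
Proof.
rewrite /spline_density; case: ifPn => // xl; rewrite lee_fin.
by apply: spline_fun_ge0 => //; exact: tail_nincr.
Qed.

Lemma numerical_segment (c d : R) : c < d ->
  nu `[c, d]%classic = ((G c)%:E - (G d)%:E)%E.
Proof.
move=> cd.
have E1 : nu `]c, +oo[%classic = (nu `]c, d]%classic + nu `]d, +oo[%classic)%E.
  rewrite -measureU//; last first.
    rewrite -subset0 => x [] /=; rewrite !in_itv /= andbT => /andP[_ xd].
    by rewrite ltNge xd.
  congr (nu _); apply/seteqP; split => x /=; rewrite !in_itv /= !andbT.
    by move=> ->; have [?|?] := leP x d; [left|right].
  by move=> [/andP[]//|]; exact: lt_trans.
have E2 : nu `[c, d]%classic = (nu [set c] + nu `]c, d]%classic)%E.
  rewrite -measureU//; last first.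
    by rewrite -subset0 => x [] /= ->; rewrite in_itv /= ltxx.
  congr (nu _); apply/seteqP; split => x /=; rewrite !in_itv /=.
    move=> /andP[cx ->]; rewrite andbT lt_neqAle cx andbT.
    by have [->|] := eqVneq c x; [left|right].
  by move=> [->|/andP[/ltW -> ->]//]; rewrite lexx ltW.
rewrite E2 (numerical_measure_point hermA charA)// add0e -!numerical_tailE E1.
by rewrite addeK// numerical_tailE.
Qed.

Lemma numerical_measure_integral (D : set T) : measurable D ->
  nu D = (\int[leb]_(x in D) spline_density lambda i j x)%E.
Proof.
move=> mD; have mf := @measurable_spline_density R n lambda i j.
apply: (@eq_measure_off R nu (density_measure leb mf spline_density_ge0) _ _ (knots lambda)) => //.
- by move=> x; exact: (numerical_measure_point hermA charA).
- by move=> x; rewrite /= /density_measure integral_set1.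
- move=> c d cd K; apply: (etrans (numerical_segment cd)).
  rewrite -(integral_spline_fun lij cd K).
  apply: eq_integral => x; rewrite inE /= in_itv /= => /K xl.
  by rewrite /spline_density (negbTE xl).
- by move=> k; rewrite (le_lt_trans _ (ltry 1))//; exact: probability_le1.
Qed.

Lemma numerical_measure_dominated : nu `<< leb.
Proof.
move=> N lN B mB BN; rewrite numerical_measure_integral//.
apply: null_set_integral => //; last exact: lN.
apply: measurable_funTS; exact: measurable_spline_density.
Qed.

(** The Radon-Nikodym derivative and [spline_density] have the same integral over every Borel set,
    hence agree almost everywhere; the knots form a finite null set, off which [BsplineE]
    applies. *)
Lemma numerical_density_ae :
  {ae leb, forall x, (0 <= numerical_density A x) && (numerical_density A x == Bspline lambda x)}.
Proof.
have aeK : {ae leb, forall x : R, x \notin knots lambda}.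
  exists [set` knots lambda]; split.
  - exact/countable_measurable/finite_set_countable/finite_seq.
  - exact/countable_lebesgue_measure0/finite_set_countable/finite_seq.
  - by move=> x /= /negP; rewrite negbK.
have aeD : ae_eq leb setT ('d (charge_of_finite_measure nu) '/d leb)
    (spline_density lambda i j).
  have dom : charge_of_finite_measure nu `<< leb by exact: numerical_measure_dominated.
  apply: integral_ae_eq => //.
  - exact: Radon_Nikodym_integrable.
  - exact: measurable_spline_density.
  - move=> E _ mE; rewrite -Radon_Nikodym_integral//.
    exact: numerical_measure_integral.
have FF : Filter (almost_everywhere leb) by exact: ae_filter_ringOfSetsType.
apply: (@filterS2 _ _ FF _ _ _ _ aeK aeD) => x xl /(_ I) dE.
have sx : spline_density lambda i j x = (spline_fun lambda i j x)%:E.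
  by rewrite /spline_density (negbTE xl).
have -> : numerical_density A x = spline_fun lambda i j x.
  by rewrite /numerical_density dE sx.
by rewrite (BsplineE lij xl) eqxx andbT -lee_fin -sx spline_density_ge0.
Qed.

End numerical_density_spline.

Theorem proposition3p1 (R : realType) (n : nat) (A : 'M[R[i]]_n)
    (lambda : 'rV[R]_n) :
  A \is hermsymmx ->
  ~~ is_scalar_mx A ->
  char_poly A = \prod_(j < n) ('X - ((lambda 0 j)%:C)%:P) ->
  [/\ numerical_measure A `<< @lebesgue_measure R,
      {ae @lebesgue_measure R, forall x, 0 <= numerical_density A x} &
      {ae @lebesgue_measure R, forall x,
        numerical_density A x = Bspline lambda x}].
Proof.
move=> hermA nsA charA; have [i [j lij]] := nonscalar_knots hermA charA nsA.
have D := numerical_density_ae hermA nsA charA lij.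
split; first exact: numerical_measure_dominated hermA nsA charA lij.
- by apply: (@filterS _ _ (ae_filter_ringOfSetsType _) _ _ _ D) => x /andP[].
- by apply: (@filterS _ _ (ae_filter_ringOfSetsType _) _ _ _ D) => x /andP[_ /eqP].
Qed.
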